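(* Let $N\ge1$ and $d>2N$, and let $X^1,\dots,X^N$ be independent simple random walks on $\mathbb{Z}^d$ started from the origin. There exists a constant $C=C(d)>0$ such that for any $z,a,b\in\mathbb{Z}^d$ with $\|z\|\ge2\max(\|a\|,\|b\|)$, $$\mathbb{E}\big[\ell_{z+X^1+\dots+X^N}(a)\,\ell_{z+X^1+\dots+X^N}(b)\big]\le C\,\big(G_N(z-a)+G_N(z-b)\big)\cdot G_N(a-b).$$
   Context: Simple random walk on $\mathbb{Z}^d$: i.i.d. increments uniform on the $2d$ neighbours of the origin. $\|\cdot\|$ is the Euclidean norm. The local time of the sum of walks is, for $x,z\in\mathbb{Z}^d$, $$\ell_{z+X^1+\dots+X^N}(x)=\sum_{t_1,\dots,t_N\ge0}\mathbf 1\big(z+X^1_{t_1}+\dots+X^N_{t_N}=x\big).$$ $g(x)=\mathbb{E}\big[\sum_{n\ge0}\mathbf 1(X^1_n=x)\big]$ is the Green's function of the simple random walk, and $G_N$ is the $N$-th convolution power of $g$: $G_1=g$, $G_k=G_{k-1}*g$ for $k\ge2$ (convolution on $\mathbb{Z}^d$). *)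

(* Defs.v *)
From HB Require Import structures.
From mathcomp Require Import all_boot all_order all_algebra finmap.
From mathcomp Require Import all_classical all_reals all_analysis.

Set Implicit Arguments.
Unset Strict Implicit.
Unset Printing Implicit Defensive.
Import Order.TTheory GRing.Theory Num.Theory.

Local Open Scope classical_set_scope.
Local Open Scope ring_scope.

(* Z^d, with the discrete sigma-algebra, so that the library's random variables
   {RV P >-> lattice d} apply. *)
Definition lattice (d : nat) : Type := 'rV[int]_d.

HB.instance Definition _ (d : nat) := GRing.Zmodule.on (lattice d).
HB.instance Definition _ (d : nat) := isPointed.Build (lattice d) 0.
HB.instance Definition _ (d : nat) :=
  @isMeasurable.Build default_measure_display (lattice d)
    (@discrete_measurable (lattice d)) (@discrete_measurable0 (lattice d))
    (@discrete_measurableC (lattice d)) (@discrete_measurableU (lattice d)).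

Definition enorm (R : realType) (d : nat) (x : lattice d) : R :=
  Num.sqrt (\sum_(i < d) ((x ord0 i)%:~R) ^+ 2).

Definition is_unit_step (d : nat) (e : lattice d) : bool :=
  [exists i : 'I_d, (e == delta_mx ord0 i) || (e == - delta_mx ord0 i)].

Section independence.
Context (disp : measure_display) (T : measurableType disp) (R : realType)
  (P : probability T R).

Definition independent_systems (I : choiceType) (F : I -> set (set T)) : Prop :=
  forall (J : {fset I}) (A : I -> set T),
    (forall i, i \in J -> F i (A i)) ->
    P (\bigcap_(i in [set` J]) A i) = (\prod_(i <- J) P (A i))%E.

Definition sigma_process (d : nat) (X : nat -> T -> lattice d) : set (set T) :=
  <<s \bigcup_t g_sigma_algebra_preimage (X t) >>.

Definition increment (d : nat) (X : nat -> T -> lattice d) (n : nat) :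
    T -> lattice d :=
  fun w => X n.+1 w - X n w.

Definition simple_random_walk (d : nat) (X : nat -> {RV P >-> lattice d}) :
    Prop :=
  [/\ forall w, X 0%N w = 0,
      independent_systems (fun n => g_sigma_algebra_preimage (increment X n)) &
      forall (n : nat) (e : lattice d),
        P (increment X n @^-1` [set e]) =
        (if is_unit_step e then ((2 * d)%:R^-1)%:E else 0%E)].

Definition independent_walks (d N : nat)
    (X : 'I_N -> nat -> {RV P >-> lattice d}) : Prop :=
  (forall i, simple_random_walk (X i)) /\
  independent_systems (fun i => sigma_process (X i)).

Definition local_time (d N : nat) (X : 'I_N -> nat -> T -> lattice d)
    (z x : lattice d) (w : T) : \bar R :=
  (\esum_(t in [set: {ffun 'I_N -> nat}])
     ((z + \sum_(i < N) X i (t i) w == x)%:R)%:E)%E.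

Definition green (d : nat) (X : nat -> T -> lattice d) (x : lattice d) :
    \bar R :=
  (\int[P]_w \sum_(0 <= n <oo) ((X n w == x)%:R)%:E)%E.

End independence.

Definition convolution (R : realType) (d : nat) (f g : lattice d -> \bar R)
    (x : lattice d) : \bar R :=
  (\esum_(y in [set: lattice d]) (f y * g (x - y)%R))%E.

(* The k-th convolution power, for k >= 1 (k = 0 also returns g). *)
Definition conv_pow (R : realType) (d : nat) (g : lattice d -> \bar R)
    (k : nat) : lattice d -> \bar R :=
  iter k.-1 (fun h => convolution h g) g.

(* Main.v *)
(* A pair of times [t_i], [s_i] of the walk [i] has either [t_i <= s_i] or
   [s_i <= t_i]; splitting the walk at the smaller one bounds the second moment
   by [2 ^ N] sums of the form
     [\sum_w G_N(w) G_k(a - z - w) G_(N-k)(b - z - w)]   ([G_0] = delta),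
   and it remains to compare such a sum with [(G_N(z-a) + G_N(z-b)) G_N(a-b)].
   This follows from [G_k(x) ~ |x| ^ -(d - 2k)].  Where [|w| >= c |z|], the
   factor [G_N(w)] is at most [C G_N(z-a)] and the other two convolve to
   [G_N(a-b)].  Where [|w| < c |z|], the last two factors are at most
   [C |z| ^ (2N - 2d)], and [G_N] has mass [O(|z| ^ 2N)] on that ball.

   The bounds on [G_k] need no local limit theorem.  With
   [rho x = sqrt (B + |x| ^ 2)], a Taylor expansion gives, up to constants,
     [(1 - avg) rho ^ -m ~ rho ^ -(m+2)]      for [0 < m < d - 2],
     [(1 - avg) rho ^ -m ~ B rho ^ -(d+2)]    for [m = d - 2],
   [avg] being the transition operator, uniformly for [B] large.  Telescoping
   [\sum_(n < M) avg ^ n (u - avg u) = u - avg ^ M u] turns this into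
   [g * rho ^ -(m+2) ~ rho ^ -m], hence the estimate of [G_k] from the one of
   [g] by induction on [k].  The upper bound on [g] and the mass of [G_N] on
   balls come from the critical exponent [m = d - 2] (with [B ~ |z| ^ 2] for
   the latter).  For the lower bound on [g], [rho ^ -(d-2) + rho ^ -(d-1)] is
   subharmonic off a ball, and the indicator of a ball is at most a multiple of
   a finite sum of heat kernels. *)

Require Import Defs.
From HB Require Import structures.
From mathcomp Require Import all_boot all_order all_algebra finmap.
From mathcomp Require Import all_classical all_reals all_analysis.
From mathcomp Require Import measurable_realfun.
From mathcomp Require Import zify ring lra.

Set Implicit Arguments.
Unset Strict Implicit.
Unset Printing Implicit Defensive.
Import Order.TTheory GRing.Theory Num.Theory.
Import numFieldNormedType.Exports.

Local Open Scope classical_set_scope.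
Local Open Scope ring_scope.

HB.instance Definition _ (d : nat) := Countable.on (lattice d).

(** * Unconditional sums *)

Section esum_complements.
Local Open Scope ereal_scope.
Context {R : realType}.

Lemma esum_exchange (I J : choiceType) (a : I -> J -> \bar R) :
  (forall i j, 0 <= a i j) ->
  \esum_(i in [set: I]) \esum_(j in [set: J]) a i j =
  \esum_(j in [set: J]) \esum_(i in [set: I]) a i j.
Proof.
move=> a0; rewrite (@esum_esum _ _ _ setT (fun=> setT))//.
rewrite (@esum_esum _ _ _ setT (fun=> setT) (fun j i => a i j))//.
rewrite (reindex_esum setT (setT `*`` (fun=> setT)) (fun k => (k.2, k.1))).
  by rewrite [RHS](_ : _ = \esum_(i in setT) a i.2 i.1)//; congr (esum _ _); apply/seteqP; split.
split => //=; first by move=> [i j] [i' j'] _ _ [-> ->].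
by move=> [i j] _; exists (j, i).
Qed.

Lemma reindex_esumT (I J : choiceType) (e : I -> J) (a : J -> \bar R) :
  bijective e ->
  \esum_(j in [set: J]) a j = \esum_(i in [set: I]) a (e i).
Proof.
by move=> be; apply: reindex_esum; rewrite setTT_bijective.
Qed.

Lemma esum_only (I : choiceType) (i0 : I) (a : I -> \bar R) :
  0 <= a i0 -> (forall i, i != i0 -> a i = 0) ->
  \esum_(i in [set: I]) a i = a i0.
Proof.
move=> a0 ai; rewrite -[RHS](esum_set1 a0) [RHS]esum_mkcond.
apply: eq_esum => i _; have [->|/ai ->] := eqVneq i i0; last by case: ifP.
by rewrite mem_set.
Qed.

(** The scalar may be [+oo], since it will be a value of a Green's function. In that case either
    every term vanishes, or one positive term makes both sides infinite. *)
Lemma esumZl (I : choiceType) (c : \bar R) (a : I -> \bar R) :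
  0 <= c -> (forall i, 0 <= a i) ->
  \esum_(i in [set: I]) (c * a i) = c * \esum_(i in [set: I]) a i.
Proof.
move=> + a0; case: c => [c|_|//]; last first.
  have [az|[i ai]] : (forall i, a i = 0) \/ exists i, a i != 0.
    have [|/existsNP[i /eqP ai]] := pselect (forall i, a i = 0); first by left.
    by right; exists i.
  by rewrite !esum1 ?mule0// => i _; rewrite ?az ?mule0.
  have ap : 0 < a i by rewrite lt0e ai a0.
  have h (b : I -> \bar R) : (forall i, 0 <= b i) -> b i <= \esum_(j in [set: I]) b j.
    move=> b0; apply: esum_ge; exists [set i] => //; rewrite fsbig_set1//.
  rewrite gt0_mulye; last by apply: lt_le_trans ap _; exact: h.
  apply/eqP; rewrite eq_le leey/=; apply: le_trans (h (fun i => +oo * a i) _) => [|j].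
    by rewrite gt0_mulye.
  by rewrite mule_ge0.
rewrite lee_fin le_eqVlt => /orP[/eqP <-|c0].
  by rewrite mul0e esum1// => i _; rewrite mul0e.
rewrite /esum -ereal_sup_pZl//; congr ereal_sup; apply/seteqP; split.
  move=> _ [X fX <-]; exists (\sum_(x \in X) a x); first by exists X.
  by rewrite ge0_mule_fsumr.
move=> _ [_ [X fX <-] <-]; exists X => //.
by rewrite ge0_mule_fsumr.
Qed.

(** Enumerating [I] by [pickle], with value 0 at the integers that code nothing, makes monotone
    convergence for series available to unconditional sums. *)
Lemma esum_nneseries (I : countType) (a : I -> \bar R) : (forall i, 0 <= a i) ->
  \esum_(i in [set: I]) a i = \sum_(n <oo) oapp a 0 (pickle_inv n).
Proof.
move=> a0; rewrite nneseries_esumT; last by move=> n; case: pickle_inv => /=.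
transitivity (\esum_(n in range (@choice.pickle I)) oapp a 0 (pickle_inv n)); last first.
  rewrite esum_mkcond; apply: eq_esum => n _; case: ifPn => // nr.
  case E : pickle_inv => [i|]//=; case/negP: nr; rewrite inE; exists i => //.
  by have := @pickle_invK I n; rewrite /ocancel E.
rewrite (reindex_esum setT (range (@choice.pickle I)) (@choice.pickle I)); last first.
  split.
  - by move=> i _; exists i.
  - by move=> i j _ _; exact: (pcan_inj (@pickleK_inv I)).
  - by [].
by apply: eq_esum => i _; rewrite pickleK_inv.
Qed.

Lemma integral_esum (d : measure_display) (T : measurableType d)
    (mu : {measure set T -> \bar R}) (I : countType) (f : I -> T -> \bar R) :
  (forall i, measurable_fun setT (f i)) -> (forall i x, 0 <= f i x) ->
  \int[mu]_x (\esum_(i in [set: I]) f i x) = \esum_(i in [set: I]) \int[mu]_x f i x.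
Proof.
move=> mf f0; rewrite esum_nneseries; last by move=> i; exact: integral_ge0.
under eq_integral do rewrite esum_nneseries//.
rewrite integral_nneseries//=; last 2 first.
- by move=> n; case: pickle_inv => [i|]//=; exact: measurable_cst.
- by move=> n x _; case: pickle_inv => /=.
by apply: eq_eseriesr => n _; case: pickle_inv => //=; rewrite integral0.
Qed.

Definition fcons (A : Type) n (a : A) (f : {ffun 'I_n -> A}) : {ffun 'I_n.+1 -> A} :=
  [ffun i => if unlift ord0 i is Some j then f j else a].

Lemma fcons0 (A : Type) n (a : A) (f : {ffun 'I_n -> A}) : fcons a f ord0 = a.
Proof. by rewrite ffunE unlift_none. Qed.

Lemma fconsS (A : Type) n (a : A) (f : {ffun 'I_n -> A}) i :
  fcons a f (lift ord0 i) = f i.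
Proof. by rewrite ffunE liftK. Qed.

Lemma esum_ffunS (A : choiceType) n (F : {ffun 'I_n.+1 -> A} -> \bar R) :
  (forall f, 0 <= F f) ->
  \esum_(f in [set: {ffun 'I_n.+1 -> A}]) F f =
  \esum_(a in [set: A]) \esum_(f in [set: {ffun 'I_n -> A}]) F (fcons a f).
Proof.
move=> F0; rewrite (@esum_esum _ _ _ setT (fun=> setT))//.
rewrite (_ : _ `*`` _ = setT); last by apply/seteqP; split.
apply: (reindex_esumT (e := fun p => fcons p.1 p.2)).
exists (fun f : {ffun 'I_n.+1 -> A} => (f ord0, [ffun j => f (lift ord0 j)])).
  by move=> [a f] /=; rewrite fcons0; congr pair; apply/ffunP => j; rewrite ffunE fconsS.
move=> f; apply/ffunP => i /=.
by case: (unliftP ord0 i) => [j|] ->; rewrite ?fconsS ?fcons0 ?ffunE.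
Qed.

Lemma esum_ffun0 (A : choiceType) (F : {ffun 'I_0 -> A} -> \bar R)
    (f0 : {ffun 'I_0 -> A}) : 0 <= F f0 ->
  \esum_(f in [set: {ffun 'I_0 -> A}]) F f = F f0.
Proof.
move=> F0; apply: esum_only => // f; case/negP; apply/eqP/ffunP => -[].
by [].
Qed.

(** Distributivity: it turns a product over the walks into a sum over tuples of times, places or
    orderings. Induction peels off coordinate 0 with [fcons]. *)
Lemma prod_esum (A : choiceType) n (c : 'I_n -> A -> \bar R) :
  (forall i a, 0 <= c i a) ->
  \prod_(i < n) (\esum_(a in [set: A]) c i a) =
  \esum_(f in [set: {ffun 'I_n -> A}]) \prod_(i < n) c i (f i).
Proof.
elim: n c => [|n IH] c c0.
  rewrite big_ord0 (@esum_ffun0 _ _ (ffun0 (card_ord 0)))//.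
    by rewrite big_ord0.
  by rewrite big_ord0.
have p0 m (c' : 'I_m -> \bar R) : (forall i, 0 <= c' i) -> 0 <= \prod_(i < m) c' i.
  by move=> ?; apply: prode_ge0.
rewrite big_ord_recl IH// esum_ffunS; last by move=> f; exact: p0.
rewrite muleC -esumZl//; last by apply: esum_ge0 => f _; exact: p0.
apply: eq_esum => a _; rewrite muleC -esumZl//; last by move=> f; exact: p0.
apply: eq_esum => f _; rewrite big_ord_recl fcons0; congr (_ * _).
by apply: eq_bigr => i _; rewrite fconsS.
Qed.

End esum_complements.

Section esum_applications.
Local Open Scope ereal_scope.
Context {R : realType}.

Lemma esum_fin (I : finType) (a : I -> \bar R) : (forall i, 0 <= a i) ->
  \esum_(i in [set: I]) a i = \sum_i a i.
Proof.
move=> a0; transitivity (\esum_(j in [set: I]) \sum_i (if j == i then a i else 0)).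
  apply: eq_esum => j _; rewrite -big_mkcond/=.
  by under eq_bigl do rewrite eq_sym; rewrite big_pred1_eq.
rewrite esum_sum; last by move=> i j _ _; case: ifP.
apply: eq_bigr => i _; rewrite (@esum_only _ _ i) ?eqxx//.
by move=> j /negbTE ->.
Qed.

Lemma mule_esum (I J : choiceType) (a : I -> \bar R) (b : J -> \bar R) :
  (forall i, 0 <= a i) -> (forall j, 0 <= b j) ->
  (\esum_(i in [set: I]) a i) * (\esum_(j in [set: J]) b j) =
  \esum_(i in [set: I]) \esum_(j in [set: J]) (a i * b j).
Proof.
move=> a0 b0; rewrite muleC -esumZl//; last by apply: esum_ge0 => j _.
by apply: eq_esum => i _; rewrite muleC esumZl.
Qed.

Lemma measurable_esum (disp : measure_display) (T : measurableType disp)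
    (I : countType) (f : I -> T -> \bar R) :
  (forall i, measurable_fun setT (f i)) -> (forall i x, 0 <= f i x) ->
  measurable_fun setT (fun x => \esum_(i in [set: I]) f i x).
Proof.
move=> mf f0.
rewrite (_ : (fun x => _) = (fun x => \sum_(n <oo) oapp (f^~ x) 0 (pickle_inv n))).
  apply: ge0_emeasurable_sum => [n x _ _|n _]; first by case: pickle_inv => /=.
  by case: pickle_inv => [i|]//=; exact: measurable_cst.
by apply/funext => x; rewrite esum_nneseries.
Qed.

End esum_applications.

(** * The discrete Laplacian of radial functions *)

(** Purely algebraic: with [p] the cubic Taylor polynomial, [p ^ 2 (1 + e) - 1] is a multiple of
    [e ^ 4]. As [y ^ 2 (1 + e) = 1], this bounds [(y - p) (y + p) (1 + e)], whose last two factors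
    have product at least 1/2. *)
Lemma invsqrt_taylor (R : realType) (e : R) : `|e| <= 2^-1 ->
  `|(Num.sqrt (1 + e))^-1 - (1 - e / 2 + 3 / 8 * e ^+ 2 - 5 / 16 * e ^+ 3)|
    <= 2 * e ^+ 4.
Proof.
move=> he; have /andP[e1 e2] : - 2^-1 <= e <= 2^-1 by rewrite -ler_norml.
have e1' : 0 < 1 + e by lra.
set y := _^-1; set p := _ - _ * e ^+ 3.
have y0 : 0 < y by rewrite invr_gt0 sqrtr_gt0.
have yE : y ^+ 2 * (1 + e) = 1.
  by rewrite exprVn sqr_sqrtr ?ltW// mulVf ?gt_eqF.
have p0 : 1 / 2 <= p by rewrite /p; nra.
have pE : p ^+ 2 * (1 + e) - 1 =
   e ^+ 4 * (- 35 / 64 + 7 / 32 * e - 35 / 256 * e ^+ 2 + 25 / 256 * e ^+ 3)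
   by rewrite /p; field.
have H : `|p ^+ 2 * (1 + e) - 1| <= e ^+ 4.
  rewrite pE normrM [X in X * _]ger0_norm; last by rewrite exprn_even_ge0.
  rewrite ler_piMr ?exprn_even_ge0// ler_norml; apply/andP; split; nra.
have {H} : `|(y - p) * ((y + p) * (1 + e))| <= e ^+ 4.
  rewrite (_ : _ * _ = y ^+ 2 * (1 + e) - p ^+ 2 * (1 + e)); last by ring.
  by rewrite yE distrC.
rewrite normrM [X in _ * X](@ger0_norm _ ((y + p) * (1 + e))); last nra.
have ype : 1 / 2 <= (y + p) * (1 + e).
  have : 0 <= y ^+ 2 * (2^-1 - e) by rewrite mulr_ge0 ?sqr_ge0//; lra.
  rewrite mulrBr; move: yE; rewrite mulrDr mulr1 => yE yh.
  have y23 : 2 / 3 <= y ^+ 2 by lra.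
  have : 1 / 2 <= y by nra.
  move=> y12; have : 1 <= y + p by lra.
  by move=> yp1; nra.
move=> hle; have : `|y - p| * (1 / 2) <= e ^+ 4.
  by apply: le_trans hle; rewrite ler_wpM2l.
by lra.
Qed.

(** Induction on [m], multiplying by one more factor [(1 + e) ^ (-1/2)]. Only the quadratic part
    must be explicit: summed over two opposite steps, the cubic part is of the order of the error in
    [radial_laplacian]. *)
Lemma invsqrtX_taylor (R : realType) (m : nat) :
  exists a C : R, 0 <= C /\ forall e, `|e| <= 2^-1 ->
  `|Num.sqrt (1 + e) ^- m -
     (1 - m%:R / 2 * e + (m * m.+2)%:R / 8 * e ^+ 2 + a * e ^+ 3)|
    <= C * e ^+ 4.
Proof.
elim: m => [|m [a [C [C0 IH]]]].
  exists 0, 0; split => // e _; rewrite expr0 invr1 !mul0r subr0 !addr0.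
  by rewrite subrr normr0.
set M : R := m%:R.
have mE : (m * m.+2)%:R = M * (M + 2) :> R by rewrite natrM -natr1 -[m.+1%:R]natr1 -addrA.
have mE' : (m.+1 * m.+3)%:R = (M + 1) * (M + 3) :> R.
  by rewrite natrM -!natr1 /M; ring.
have mE'' : m.+1%:R = M + 1 :> R by rewrite -natr1.
set b2 := M * (M + 2) / 8.
(* [a'] is the cubic coefficient of the product of the two Taylor polynomials; [K] bounds the
   polynomial [P] of degree [m]. *)
pose a' := a - b2 / 2 - M / 2 * (3 / 8) - 5 / 16.
pose K := 1 + M / 2 + b2 + `|a|.
have M0 : 0 <= M by rewrite ler0n.
have b20 : 0 <= b2 by rewrite /b2; nra.
have K1 : 1 <= K by have := normr_ge0 a; rewrite /K; lra.
exists a', (C * 2 + K * 2 + 4 * K); split; first by nra.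
move=> e he; have /andP[e1 e2] : - 2^-1 <= e <= 2^-1 by rewrite -ler_norml.
have := IH _ he; have := invsqrt_taylor he.
rewrite [Num.sqrt _ ^+ m.+1]exprS invfM mE mE' mE''.
set y := (Num.sqrt _)^-1; set F := _ ^- m.
set Q := 1 - e / 2 + _ - _; set P := 1 - _ + _ * e ^+ 2 + _.
set T := 1 - _ + _ + _.
move=> hy hF.
have e4 : 0 <= e ^+ 4 by rewrite exprn_even_ge0.
have y2 : `|y| <= 2.
  rewrite ger0_norm ?invr_ge0 ?sqrtr_ge0//.
  rewrite invf_ple ?posrE ?sqrtr_gt0//; last lra.
  have s1 := sqrtr_ge0 (1 + e); have := @sqr_sqrtr _ (1 + e); nra.
have PK : `|P| <= K.
  have ha : `|a * e ^+ 3| <= `|a|.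
    by rewrite normrM ler_piMr// normrX exprn_ile1//; lra.
  have : `|a * e ^+ 3 + (1 - M / 2 * e + b2 * e ^+ 2)| <= `|a| + (1 + M / 2 + b2).
    rewrite (le_trans (ler_normD _ _))// lerD// ler_norml.
    have : e ^+ 2 <= 1 by nra.
    have : 0 <= e ^+ 2 by rewrite sqr_ge0.
    by move=> ? ?; apply/andP; split; nra.
  have -> : P = a * e ^+ 3 + (1 - M / 2 * e + b2 * e ^+ 2).
    by rewrite /P /b2; field.
  by rewrite /K => h; lra.
(* The error splits into that of [F] times [y <= 2], that of [y] times [P], and the terms of degree
   at least 4 in [P * Q]. They account for the three summands of the constant. *)
have E : y * F - T = (F - P) * y + P * (y - Q) + e ^+ 4 *
   (b2 * (3 / 8) + a * (- 1 / 2) + M / 2 * (5 / 16)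
     + (a * (3 / 8) + b2 * (- 5 / 16)) * e + a * (- 5 / 16) * e ^+ 2).
  by rewrite /T /P /Q /a' /b2; field.
rewrite E (le_trans (ler_normD _ _))//.
have -> : (C * 2 + K * 2 + 4 * K) * e ^+ 4 =
    (C * e ^+ 4 * 2 + K * (2 * e ^+ 4)) + e ^+ 4 * (4 * K) by ring.
apply: lerD.
  rewrite (le_trans (ler_normD _ _))// !normrM; apply: lerD; apply: ler_pM => //.
rewrite normrM ger0_norm// ler_wpM2l//.
have := ler_norm a; have := ler_norm (- a); rewrite normrN => a1 a2.
have /andP[ae1 ae2] : - `|a| <= a * e <= `|a|.
  by rewrite -ler_norml normrM ler_piMr//; lra.
have /andP[af1 af2] : - `|a| <= a * e ^+ 2 <= `|a|.
  by rewrite -ler_norml normrM ler_piMr// normrX exprn_ile1//; lra.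
have be1 : b2 * e <= b2 by nra.
have be2 : - b2 <= b2 * e by nra.
by rewrite ler_norml; apply/andP; split; rewrite /K; lra.
Qed.

Section radial.
Context (R : realType) (d : nat).
Implicit Types (x y : lattice d) (B : R) (f g : lattice d -> R).

Definition sqnorm x : R := \sum_(i < d) ((x ord0 i)%:~R) ^+ 2.

Definition step (e : 'I_d * bool) : lattice d :=
  if e.2 then delta_mx ord0 e.1 else - delta_mx ord0 e.1.

Definition avg f x : R := (2 * d)%:R^-1 * \sum_e f (x - step e).

Definition rho B x : R := Num.sqrt (B + sqnorm x).

Lemma sqnorm_ge0 x : 0 <= sqnorm x.
Proof. by apply: sumr_ge0 => i _; rewrite sqr_ge0. Qed.

Lemma sqr_rho B x : 0 <= B -> rho B x ^+ 2 = B + sqnorm x.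
Proof. by move=> B0; rewrite sqr_sqrtr// addr_ge0// sqnorm_ge0. Qed.

Lemma sqnorm_step x (i : 'I_d) (b : bool) :
  sqnorm (x - step (i, b)) = sqnorm x + 1 + (-1) ^+ b * 2 * (x ord0 i)%:~R.
Proof.
rewrite /sqnorm (bigD1 i)//= [in RHS](bigD1 i)//=.
have -> : \sum_(j < d | j != i) ((x - step (i, b)) ord0 j)%:~R ^+ 2 =
          \sum_(j < d | j != i) (x ord0 j)%:~R ^+ 2 :> R.
  apply: eq_bigr => j ji; congr (_ ^+ 2); rewrite /step /=.
  by case: b; rewrite !mxE (negbTE ji) andbF ?subr0// oppr0 subr0.
rewrite /step; case: b => /=; rewrite !mxE !eqxx/= intrB ?opprK ?intrN; ring.
Qed.

Lemma sum_step (F : 'I_d * bool -> R) :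
  \sum_e F e = \sum_i (F (i, true) + F (i, false)).
Proof.
rewrite (eq_bigr (fun p => F (p.1, p.2))); last by case.
  rewrite -(pair_big xpredT xpredT (fun i b => F (i, b)))/=.
by apply: eq_bigr => i _; rewrite big_bool.
Qed.

(* [36 <= B] makes the relative increments [(1 +- 2 x_i) / (B + |x| ^ 2)] of
   [rho ^ 2] at most [1/2] in absolute value. *)
Lemma radial_laplacian (m : nat) : exists K : R, 0 <= K /\
  forall B x, 36 <= B ->
  `|rho B x ^+ m * \sum_e (rho B x ^- m - rho B (x - step e) ^- m)
    - (m%:R * (d%:R - 2 - m%:R) / (B + sqnorm x)
       + m%:R * m.+2%:R * B / (B + sqnorm x) ^+ 2)| <= K / (B + sqnorm x) ^+ 2.
Proof.
have [a [C [C0 HT]]] := invsqrtX_taylor R m.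
set M : R := m%:R; set b2 : R := (m * m.+2)%:R / 8.
have b20 : 0 <= b2 by rewrite /b2 mulr_ge0 ?ler0n// invr_ge0.
(* The summands are: what [e1 ^ 2 + e2 ^ 2] leaves beside its [8 y ^ 2 / s ^ 2]; the cubic part,
   where [2 + 24 y ^ 2 <= 25 s]; and two remainders, each with [e ^ 4 <= 81 / s ^ 2]. *)
pose K := b2 * 2 + `|a| * 25 + C * 162.
exists (d%:R * K); split; first by rewrite mulr_ge0 ?ler0n// /K; have := normr_ge0 a; lra.
move=> B x B36; set s := B + sqnorm x.
have S0 := sqnorm_ge0 x.
have s36 : 36 <= s by rewrite /s; lra.
have s0 : s != 0 by rewrite gt_eqF//; lra.
have Y i : ((x ord0 i)%:~R : R) ^+ 2 <= s.
  rewrite /s /sqnorm (bigD1 i)//= addrCA lerDl addr_ge0//; first lra.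
  by apply: sumr_ge0 => j _; rewrite sqr_ge0.
have r0 : 0 < rho B x by rewrite sqrtr_gt0 -/s; lra.
pose y i : R := (x ord0 i)%:~R.
have key i (b : bool) : rho B x ^+ m * rho B (x - step (i, b)) ^- m =
    Num.sqrt (1 + (1 + (-1) ^+ b * 2 * y i) / s) ^- m.
  rewrite -exprVn -exprMn -exprVn; congr (_ ^+ m).
  rewrite /rho sqnorm_step -/s.
  have -> : B + (sqnorm x + 1 + (-1) ^+ b * 2 * (x ord0 i)%:~R) =
     s * (1 + (1 + (-1) ^+ b * 2 * y i) / s) by rewrite /s/y; field.
  rewrite sqrtrM; last lra.
  by rewrite invfM mulrA mulfV ?mul1r// gt_eqF// sqrtr_gt0; lra.
have small i (b : bool) : let e := (1 + (-1) ^+ b * 2 * y i) / s in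
    `|e| <= 2^-1 /\ e ^+ 4 <= 81 / s ^+ 2.
  move=> e.
  have e2 : e ^+ 2 <= 9 / s.
    rewrite /e exprMn exprVn ler_pdivrMr ?exprn_gt0//; last lra.
    have -> : 9 / s * s ^+ 2 = 9 * s by field.
    have := Y i; rewrite -/(y i); case: b {e} => /=; rewrite ?expr0 ?expr1; nra.
  split.
    rewrite -(@ler_pXn2r _ 2) ?nnegrE ?invr_ge0// real_normK ?num_real//.
    rewrite (le_trans e2)// ler_pdivrMr; last lra.
    rewrite exprVn; lra.
  rewrite (_ : e ^+ 4 = (e ^+ 2) ^+ 2); last by rewrite -exprM.
  rewrite (_ : 81 / s ^+ 2 = (9 / s) ^+ 2); last by field.
  by rewrite ler_pXn2r ?nnegrE ?sqr_ge0// divr_ge0//; lra.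
(* Adding the two opposite steps along axis [i] cancels the part of the expansion that is linear in
   [y i]. *)
have per i : `|(2 - (rho B x ^+ m * rho B (x - step (i, true)) ^- m +
                rho B x ^+ m * rho B (x - step (i, false)) ^- m))
           - (M / s - M * m.+2%:R * y i ^+ 2 / s ^+ 2)| <= K / s ^+ 2.
  rewrite !key.
  have [h1 h1'] := small i true; have [h2 h2'] := small i false.
  move: (HT _ h1) (HT _ h2) h1' h2'.
  set e1 := (1 + (-1) ^+ true * _ * _) / s.
  set e2 := (1 + (-1) ^+ false * _ * _) / s.
  set F1 := _ ^- m; set F2 := _ ^- m.
  set P1 := 1 - _ + _ + _; set P2 := 1 - _ + _ + _ => H1 H2 h1' h2'.
  have -> : 2 - (F1 + F2) - (M / s - M * m.+2%:R * y i ^+ 2 / s ^+ 2)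
     = - (b2 * 2 / s ^+ 2) - a * (2 + 24 * y i ^+ 2) / s / s ^+ 2
        - ((F1 - P1) + (F2 - P2)).
    by rewrite /P1 /P2 /e1 /e2 /b2 natrM -/M; field.
  rewrite (le_trans (ler_normB _ _))//.
  have -> : K / s ^+ 2 = b2 * 2 / s ^+ 2 + `|a| * 25 / s ^+ 2 + C * 162 / s ^+ 2.
    by rewrite /K; field.
  have s2 : 0 < s ^+ 2 by rewrite exprn_gt0//; lra.
  apply: lerD.
    rewrite (le_trans (ler_normB _ _))// normrN lerD//.
      by rewrite ger0_norm// mulr_ge0 ?invr_ge0 ?(ltW s2)// mulr_ge0.
    have q0 : 0 <= (2 + 24 * y i ^+ 2) / s.
      by rewrite divr_ge0//; [have := sqr_ge0 (y i); lra|lra].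
    have -> : a * (2 + 24 * y i ^+ 2) / s / s ^+ 2 =
              a * ((2 + 24 * y i ^+ 2) / s) * (s ^+ 2)^-1 by field.
    rewrite normrM (@ger0_norm _ (s ^+ 2)^-1) ?invr_ge0 ?(ltW s2)//.
    rewrite ler_wpM2r ?invr_ge0 ?(ltW s2)// normrM ler_wpM2l// ger0_norm//.
    rewrite ler_pdivrMr; last lra.
    by have := Y i; rewrite -/(y i); lra.
  rewrite (le_trans (ler_normD _ _))//.
  have -> : C * 162 / s ^+ 2 = C * (81 / s ^+ 2) + C * (81 / s ^+ 2) by field.
  by apply: lerD; [apply: le_trans H1 _|apply: le_trans H2 _]; rewrite ler_wpM2l.
have -> : rho B x ^+ m * (\sum_e (rho B x ^- m - rho B (x - step e) ^- m)) =
  \sum_i (2 - (rho B x ^+ m * rho B (x - step (i, true)) ^- m +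
                rho B x ^+ m * rho B (x - step (i, false)) ^- m)).
  rewrite sum_step mulr_sumr; apply: eq_bigr => i _.
  have : rho B x ^+ m * rho B x ^- m = 1 by rewrite mulfV// expf_neq0// gt_eqF.
  set u := rho B x ^+ m; set v := rho B x ^- m; move=> uv.
  by rewrite (_ : 2 = 1 + 1)// -{1 2}uv; ring.
(* Summing over the axes, [\sum_i y i ^ 2 = s - B]. The dimension enters here, and with it the
   vanishing of the leading coefficient at [m = d - 2]. *)
have -> : M * (d%:R - 2 - M) / s + M * m.+2%:R * B / s ^+ 2 =
   \sum_i (M / s - M * m.+2%:R * y i ^+ 2 / s ^+ 2).
  rewrite sumrB sumr_const card_ord -mulr_suml -mulr_sumr -/(sqnorm x).
  rewrite -[_ *+ d]mulr_natl.
  rewrite (_ : sqnorm x = s - B); last by rewrite /s; ring.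
  by rewrite -[m.+2%:R]natr1 -[m.+1%:R]natr1 -/M; field.
rewrite -sumrB (le_trans (ler_norm_sum _ _ _))//.
apply: (@le_trans _ _ (\sum_(i < d) K / s ^+ 2)); first exact: ler_sum.
by rewrite sumr_const card_ord -[_ *+ d]mulr_natl mulrA.
Qed.

End radial.

(** * Potentials and the Green's function *)

Section averaging.
Context (R : realType) (d : nat).
Implicit Types (x y : lattice d) (B : R) (f g u w : lattice d -> R).

Lemma avg_ge0 f : (forall x, 0 <= f x) -> forall x, 0 <= avg f x.
Proof. by move=> f0 x; rewrite mulr_ge0 ?invr_ge0 ?ler0n// sumr_ge0. Qed.

Lemma avg_le f g : (forall x, f x <= g x) -> forall x, avg f x <= avg g x.
Proof.
by move=> fg x; rewrite ler_wpM2l ?invr_ge0 ?ler0n//; apply: ler_sum.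
Qed.

Lemma avg_lincomb (a b : R) f g :
  avg (fun x => a * f x + b * g x) = (fun x => a * avg f x + b * avg g x).
Proof.
by apply/funext => x; rewrite /avg big_split/= -!mulr_sumr; ring.
Qed.

Lemma iter_avg_lincomb (a b : R) n f g : iter n (@avg R d) (fun x => a * f x + b * g x) =
  (fun x => a * iter n (@avg R d) f x + b * iter n (@avg R d) g x).
Proof. by elim: n => //= n ->; rewrite avg_lincomb. Qed.

Lemma iter_avg_ge0 n f : (forall x, 0 <= f x) -> forall x, 0 <= iter n (@avg R d) f x.
Proof. by move=> f0; elim: n => //= n IH; exact: avg_ge0. Qed.

Lemma iter_avg_le n f g : (forall x, f x <= g x) ->
  forall x, iter n (@avg R d) f x <= iter n (@avg R d) g x.
Proof. by move=> fg; elim: n => //= n IH; exact: avg_le. Qed.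

Lemma iter_avgB n f g : iter n (@avg R d) (fun x => f x - g x) =
  (fun x => iter n (@avg R d) f x - iter n (@avg R d) g x).
Proof.
have -> : (fun x => f x - g x) = (fun x => 1 * f x + (-1) * g x).
  by apply/funext => x; ring.
by rewrite iter_avg_lincomb; apply/funext => x; ring.
Qed.

Lemma iter_avgZ n (c : R) f : iter n (@avg R d) (fun x => c * f x) =
  (fun x => c * iter n (@avg R d) f x).
Proof.
have -> : (fun x => c * f x) = (fun x => c * f x + 0 * f x).
  by apply/funext => x; ring.
by rewrite iter_avg_lincomb; apply/funext => x; ring.
Qed.

Lemma avg_cst (c : R) : (0 < d)%N -> @avg R d (fun=> c) = fun=> c.
Proof.
move=> d0; apply/funext => x; rewrite /avg sumr_const card_prod card_ord card_bool.
by rewrite -(mulr_natl c) mulrA (mulnC d) mulVf ?mul1r// pnatr_eq0 muln_eq0 -lt0n d0.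
Qed.

Lemma sub_avg f x : (0 < d)%N ->
  f x - avg f x = (2 * d)%:R^-1 * \sum_e (f x - f (x - step e)).
Proof.
by move=> d0; rewrite sumrB mulrBr -/(avg (fun=> f x) x) avg_cst.
Qed.

Lemma sum_iter_avg_sub u n x :
  \sum_(0 <= k < n) iter k (@avg R d) (fun y => u y - avg u y) x
  = u x - iter n (@avg R d) u x.
Proof.
elim: n => [|n IH]; first by rewrite big_nil subrr.
by rewrite big_nat_recr//= IH iter_avgB -iterSr /=; ring.
Qed.

(** The Green operator, inverse of [1 - avg]; [convolution_pot] identifies it with convolution by
    the Green's function. Values are extended reals because convergence is not assumed. *)
Definition pot f x : \bar R := (\sum_(0 <= n <oo) (iter n (@avg R d) f x)%:E)%E.

Lemma pot_ge0 f x : (forall y, 0 <= f y) -> (0 <= pot f x)%E.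
Proof. by move=> f0; apply: nneseries_ge0 => n _ _; rewrite lee_fin iter_avg_ge0. Qed.

Lemma pot_le f g x : (forall y, 0 <= f y) -> (forall y, f y <= g y) ->
  (pot f x <= pot g x)%E.
Proof.
by move=> f0 fg; apply: lee_nneseries => n *; rewrite lee_fin ?iter_avg_ge0 ?iter_avg_le.
Qed.

Lemma potZ (c : R) f x : 0 <= c -> (forall y, 0 <= f y) ->
  (pot (fun y => c * f y)%R x = c%:E * pot f x)%E.
Proof.
move=> c0 f0; rewrite /pot -nneseriesZl//; last first.
  by move=> n _; rewrite lee_fin iter_avg_ge0.
by apply: eq_eseriesr => n _; rewrite iter_avgZ EFinM.
Qed.

(** By telescoping, the partial sums of [pot f] are at most [u - avg ^ n u], and the subtracted term
    is nonnegative. *)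
Lemma pot_le_super f u x : (forall y, 0 <= f y) -> (forall y, 0 <= u y) ->
  (forall y, f y <= u y - avg u y) -> (pot f x <= (u x)%:E)%E.
Proof.
move=> f0 u0 fu; apply: lime_le.
  by apply: is_cvg_nneseries => n _ _; rewrite lee_fin iter_avg_ge0.
apply: nearW => n; rewrite sumEFin lee_fin.
apply: (@le_trans _ _ (\sum_(0 <= k < n) iter k (@avg R d) (fun y => u y - avg u y) x)).
  by apply: ler_sum => k _; exact: iter_avg_le.
by rewrite sum_iter_avg_sub gerBl iter_avg_ge0.
Qed.

(* The finite potential of [w] makes [avg ^ n w], hence [avg ^ n u], tend to 0. *)
Lemma le_pot f u w (Cw : R) x : (forall y, 0 <= f y) ->
  (forall y, u y - avg u y <= f y) ->
  (forall y, 0 <= w y) -> (pot w x <= Cw%:E)%E ->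
  (forall e : R, 0 < e -> exists C : R, forall y, u y <= e + C * w y) ->
  (0 < d)%N ->
  ((u x)%:E <= pot f x)%E.
Proof.
move=> f0 fu w0 potw uw d0; apply/lee_addgt0Pr => e e0.
have [C hC] := uw _ (divr_gt0 e0 (ltr0n R 2)).
have cw : (fun n => iter n (@avg R d) w x) @ \oo --> (0 : R^o).
  apply: cvg_series_cvg_0.
  apply: nondecreasing_is_cvgn.
    by apply: nondecreasing_series => n _ _; exact: iter_avg_ge0.
  exists Cw => _ [n _ <-]; rewrite -lee_fin -sumEFin.
  apply: le_trans potw.
  by apply: nneseries_lim_ge => k _ _; rewrite lee_fin iter_avg_ge0.
have {cw} [n hn] : exists n, C * iter n (@avg R d) w x <= e / 2.
  (* The constant [C] has no prescribed sign, and one divides by this bound of it. *)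
  have C1 : 0 < `|C| + 1 by rewrite ltr_wpDl.
  have /cvgr0Pnorm_le/(_ _ (divr_gt0 (divr_gt0 e0 (ltr0n R 2)) C1)) := cw.
  case=> n _ /(_ n (leqnn n)) /= hn; exists n.
  rewrite ger0_norm ?iter_avg_ge0// in hn.
  rewrite ler_pdivlMr// in hn.
  apply: le_trans hn; rewrite mulrC ler_wpM2l ?iter_avg_ge0//.
  by rewrite (le_trans (ler_norm _))// lerDl.
have hiter : iter n (@avg R d) u x <= e.
  apply: (@le_trans _ _ (iter n (@avg R d) (fun y => 1 * (fun=> e / 2) y + C * w y) x)).
    by apply: iter_avg_le => y; rewrite mul1r.
  rewrite iter_avg_lincomb mul1r (_ : iter n (@avg R d) (fun=> e / 2) = fun=> e / 2).
    by lra.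
  by elim: (n) => //= k ->; rewrite avg_cst.
have -> : u x = \sum_(0 <= k < n) iter k (@avg R d) (fun y => u y - avg u y) x
     + iter n (@avg R d) u x by rewrite sum_iter_avg_sub subrK.
rewrite EFinD; apply: leeD; last by rewrite lee_fin.
apply: (@le_trans _ _ (\sum_(0 <= k < n) (iter k (@avg R d) f x)%:E)%E).
  by rewrite sumEFin lee_fin; apply: ler_sum => k _; exact: iter_avg_le.
by apply: nneseries_lim_ge => k _; rewrite lee_fin iter_avg_ge0.
Qed.

End averaging.

(** * Potentials of the negative powers of [rho] *)

Section radial_estimates.
Context (R : realType) (d : nat).
Hypothesis d3 : (2 < d)%N.
Implicit Types (x y : lattice d) (B : R) (f g u w : lattice d -> R).

(** A single [A] serves as threshold for [B] and as error constant for all exponents [m <= d], so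
    that [B >= A] lets the term in [B] absorb the error. *)
Definition laplacian_bound (A : R) := 36 <= A /\
  forall (m : nat) B x, (m <= d)%N -> A <= B ->
  `|rho B x ^+ m * \sum_e (rho B x ^- m - rho B (x - step e) ^- m)
    - (m%:R * (d%:R - 2 - m%:R) / rho B x ^+ 2
       + m%:R * m.+2%:R * B / rho B x ^+ 4)| <= A / rho B x ^+ 4.

Lemma laplacian_bound_exists : exists A, laplacian_bound A.
Proof.
have /choice[K hK] := @radial_laplacian R d.
have KA m : (m <= d)%N -> K m <= 36 + \sum_(i < d.+1) K i.
  move=> md; rewrite (bigD1 (Ordinal (md : (m < d.+1)%N)))//= addrCA lerDl.
  by rewrite addr_ge0// sumr_ge0// => i _; case: (hK i).
exists (36 + \sum_(i < d.+1) K i); split.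
  by rewrite lerDl sumr_ge0// => i _; case: (hK i).
move=> m B x md AB.
have B36 : 36 <= B by rewrite (le_trans _ AB)// lerDl sumr_ge0// => i _; case: (hK i).
have s0 : 0 <= B by lra.
have [_ /(_ B x B36)] := hK m.
rewrite (_ : rho B x ^+ 4 = (rho B x ^+ 2) ^+ 2); last by rewrite -exprM.
rewrite sqr_rho// => h; apply: (le_trans h).
by rewrite ler_wpM2r ?KA// invr_ge0 exprn_ge0// addr_ge0// sqnorm_ge0.
Qed.

Variable A : R.
Hypothesis hA : laplacian_bound A.

Let A36 : 36 <= A. Proof. by case: hA. Qed.
Let d0 : (0 < d)%N. Proof. by apply: leq_trans d3. Qed.

Lemma rho_ge1 B x : A <= B -> 1 <= rho B x.
Proof.
move=> AB; rewrite -sqrtr1 ler_sqrt; have := A36; have := @sqnorm_ge0 R d x; lra.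
Qed.

Lemma rho_gt0 B x : A <= B -> 0 < rho B x.
Proof. by move=> AB; apply: lt_le_trans (rho_ge1 x AB). Qed.

Lemma rad_ge0 B m x : 0 <= rho B x ^- m.
Proof. by rewrite invr_ge0 exprn_ge0// sqrtr_ge0. Qed.

Lemma rho_sqr_ge B x : A <= B -> B <= rho B x ^+ 2.
Proof. by move=> AB; rewrite sqr_rho; have := A36; have := @sqnorm_ge0 R d x; lra. Qed.

Let sub_avg_rad B m x : A <= B ->
  rho B x ^- m - avg (fun y => rho B y ^- m) x = (2 * d)%:R^-1 * (rho B x ^- m *
   (rho B x ^+ m * \sum_e (rho B x ^- m - rho B (x - step e) ^- m))).
Proof.
move=> AB; have r0 := rho_gt0 x AB.
by rewrite mulKf ?expf_neq0 ?gt_eqF// -(sub_avg (fun y => rho B y ^- m)).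
Qed.

Let D0 : 0 < (2 * d)%:R^-1 :> R.
Proof. by rewrite invr_gt0 ltr0n muln_gt0. Qed.

Lemma rad_critical B m x : d = m.+2 -> A <= B ->
  (2 * d)%:R^-1 * (B * rho B x ^- m.+4)
    <= rho B x ^- m - avg (fun y => rho B y ^- m) x.
Proof.
move=> dm AB; rewrite sub_avg_rad//.
have r0 := rho_gt0 x AB.
rewrite ler_pM2l// -[m.+4]addn4 exprD invfM mulrCA ler_wpM2l ?rad_ge0//.
have [_ /(_ m B x)] := hA; rewrite {1}dm => /(_ (leqW (leqW (leqnn m))) AB).
set X := rho B x ^+ m * _; rewrite ler_norml => /andP[+ _].
have -> : d%:R - 2 - m%:R = 0 :> R by rewrite dm -[m.+2%:R]natr1 -[m.+1%:R]natr1; ring.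
rewrite mulr0 mul0r add0r => h.
have m1 : 1 <= m%:R :> R by rewrite ler1n; move: d3; rewrite dm.
have r4 : 0 <= rho B x ^- 4 by rewrite rad_ge0.
apply: le_trans (_ : (m%:R * m.+2%:R * B - A) / rho B x ^+ 4 <= _); last first.
  by rewrite mulrBl; lra.
rewrite ler_wpM2r// -[m.+2%:R]natr1 -[m.+1%:R]natr1.
move: m1 AB; have := A36; set M := m%:R => *; nra.
Qed.

(** Here [d - 2 - m >= 1], so the term in [rho ^ -2] gives the bound while the term in [B] pays for
    the error. *)
Lemma rad_subcritical B m x : (0 < m)%N -> (m.+2 < d)%N -> A <= B ->
  (2 * d)%:R^-1 * rho B x ^- m.+2
    <= rho B x ^- m - avg (fun y => rho B y ^- m) x.
Proof.
move=> m0 dm AB; rewrite sub_avg_rad//.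
have r0 := rho_gt0 x AB.
rewrite ler_pM2l// -[m.+2]addn2 exprD invfM ler_wpM2l ?rad_ge0//.
have [_ /(_ m B x)] := hA; move=> /(_ (ltnW (ltnW (ltnW dm))) AB).
set X := rho B x ^+ m * _; rewrite ler_norml => /andP[+ _].
have m1 : 1 <= m%:R :> R by rewrite ler1n.
have md1 : 1 <= d%:R - 2 - m%:R :> R.
  have : (m.+3)%:R <= d%:R :> R by rewrite ler_nat.
  by rewrite -[m.+3%:R]natr1 -[m.+2%:R]natr1 -[m.+1%:R]natr1; lra.
have r4 : 0 <= rho B x ^- 4 by rewrite rad_ge0.
have r2 : 0 <= rho B x ^- 2 by rewrite rad_ge0.
have h1 : A * rho B x ^- 4 <= m%:R * m.+2%:R * B / rho B x ^+ 4.
  rewrite ler_wpM2r// -[m.+2%:R]natr1 -[m.+1%:R]natr1.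
  by move: m1 AB; have := A36; set M := m%:R => *; nra.
have h2 : rho B x ^- 2 <= m%:R * (d%:R - 2 - m%:R) / rho B x ^+ 2.
  by rewrite ler_peMl//; nra.
by lra.
Qed.

(** Since [A <= rho A x ^ 2], every term of the expansion is at most of order [rho ^ -2]; the
    constant covers all [m <= d]. *)
Lemma rad_laplacian_le m x : (m <= d)%N ->
  rho A x ^- m - avg (fun y => rho A y ^- m) x <=
  (d%:R * d%:R + d%:R * d.+2%:R + 1) * rho A x ^- m.+2.
Proof.
move=> md; rewrite sub_avg_rad//.
have r0 := rho_gt0 x (lexx A).
have [_ /(_ m A x)] := hA; move=> /(_ md (lexx A)).
set X := rho A x ^+ m * _; rewrite ler_norml => /andP[_ h].
have mdR : m%:R <= d%:R :> R by rewrite ler_nat.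
have m0R : 0 <= m%:R :> R by [].
have r2 : 0 <= rho A x ^- 2 by rewrite rad_ge0.
set q := rho A x ^- 2 in r2.
have q4 : A * rho A x ^- 4 <= q.
  rewrite (_ : rho A x ^- 4 = q * q); last by rewrite /q -invfM -exprD.
  rewrite mulrA ler_piMl//.
  by rewrite ler_pdivrMr ?exprn_gt0// mul1r rho_sqr_ge.
have hX : X <= (d%:R * d%:R + d%:R * d.+2%:R + 1) * q.
  have : m%:R * (d%:R - 2 - m%:R) / rho A x ^+ 2 <= d%:R * d%:R * q.
    rewrite ler_wpM2r//; apply: (@le_trans _ _ (m%:R * d%:R)).
      by rewrite ler_wpM2l//; lra.
    by rewrite ler_wpM2r.
  have : m%:R * m.+2%:R * A / rho A x ^+ 4 <= d%:R * d.+2%:R * q.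
    rewrite -mulrA; apply: ler_pM; rewrite ?mulr_ge0 ?rad_ge0//.
      by have := A36; lra.
    by apply: ler_pM => //; rewrite ler_nat.
  by move: h; rewrite !mulrDl mul1r; lra.
have -> : rho A x ^- m.+2 = rho A x ^- m * q by rewrite /q -invfM -exprD addn2.
rewrite [leRHS]mulrCA -[leRHS]mul1r.
apply: le_trans (_ : (2 * d)%:R^-1 *
  (rho A x ^- m * ((d%:R * d%:R + d%:R * d.+2%:R + 1) * q)) <= _).
  by rewrite ler_pM2l// ler_wpM2l// rad_ge0.
rewrite ler_wpM2r//.
  by rewrite mulr_ge0 ?rad_ge0// mulr_ge0// !addr_ge0// mulr_ge0.
by rewrite invf_le1 ?ltr0n ?muln_gt0// ler1n muln_gt0.
Qed.

Lemma pot_rad_subcritical B m x : (0 < m)%N -> (m.+2 < d)%N -> A <= B ->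
  (pot (fun y => rho B y ^- m.+2) x <= ((2 * d)%:R * rho B x ^- m)%:E)%E.
Proof.
move=> m0 dm AB.
apply: (@pot_le_super _ _ _ (fun y => (2 * d)%:R * rho B y ^- m)).
- by move=> y; exact: rad_ge0.
- by move=> y; rewrite mulr_ge0 ?rad_ge0.
- move=> y.
  have -> : avg (fun y => (2 * d)%:R * rho B y ^- m) y = (2 * d)%:R * avg (fun y => rho B y ^- m) y.
    by have := iter_avgZ 1 (2 * d)%:R (fun y => rho B y ^- m); move=> /(congr1 (fun f => f y)).
  by rewrite -mulrBr -ler_pdivrMl ?ltr0n ?muln_gt0//; apply: rad_subcritical.
Qed.

Lemma pot_rad_critical B m x : d = m.+2 -> A <= B ->
  (pot (fun y => B * rho B y ^- m.+4)%R x <= ((2 * d)%:R * rho B x ^- m)%:E)%E.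
Proof.
move=> dm AB.
apply: (@pot_le_super _ _ _ (fun y => (2 * d)%:R * rho B y ^- m)).
- by move=> y; rewrite mulr_ge0 ?rad_ge0//; have := A36; lra.
- by move=> y; rewrite mulr_ge0 ?rad_ge0.
- move=> y.
  have -> : avg (fun y => (2 * d)%:R * rho B y ^- m) y = (2 * d)%:R * avg (fun y => rho B y ^- m) y.
    by have := iter_avgZ 1 (2 * d)%:R (fun y => rho B y ^- m); move=> /(congr1 (fun f => f y)).
  by rewrite -mulrBr -ler_pdivrMl ?ltr0n ?muln_gt0//; apply: rad_critical.
Qed.

(** The control function for [le_pot]: positive everywhere, with a finite potential by the critical
    estimate, [d.+2] being the exponent [m.+4] for [m = d - 2]. *)
Let w y : R := A * rho A y ^- d.+2.

Let w_ge0 y : 0 <= w y.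
Proof. by rewrite mulr_ge0 ?rad_ge0//; have := A36; lra. Qed.

Let pot_w x : (pot w x <= ((2 * d)%:R * rho A x ^- d.-2)%:E)%E.
Proof.
have dE : d = d.-2.+2 by move: d3; case: (d) => [|[|]].
rewrite /w; have -> : d.+2 = d.-2.+4 by congr _.+2.
exact: pot_rad_critical.
Qed.

(** Where [K / rho] exceeds [e], [rho] is at most [K / e], so [w] is bounded below there and a large
    multiple of it dominates. *)
Lemma rho_inv_small (K e : R) : 0 <= K -> 0 < e ->
  exists C, forall y, K * (rho A y)^-1 <= e + C * w y.
Proof.
move=> K0 e0; exists (K * (K / e) ^+ d.+1) => y.
have r0 := rho_gt0 y (lexx A); have r1 := rho_ge1 y (lexx A).
have C0 : 0 <= K * (K / e) ^+ d.+1 by rewrite mulr_ge0// exprn_ge0// divr_ge0// ltW.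
have [le|gt] := lerP (K * (rho A y)^-1) e.
  by rewrite (le_trans le)// lerDl mulr_ge0.
apply: le_trans (_ : K * (K / e) ^+ d.+1 * w y <= _); last by rewrite lerDr ltW.
rewrite -mulrA ler_wpM2l// /w.
have rK : rho A y <= K / e.
  by rewrite ler_pdivlMr// mulrC -ler_pdivlMr// ltW.
apply: le_trans (_ : rho A y ^+ d.+1 * (1 * rho A y ^- d.+2) <= _).
  by rewrite mul1r [_ ^+ d.+2]exprSr invfM mulrA mulfV ?mul1r// expf_neq0// gt_eqF.
apply: ler_pM; rewrite ?exprn_ge0 ?mul1r ?rad_ge0 ?(ltW r0)//.
  by apply: lerXn2r => //; rewrite nnegrE ?(ltW r0)// divr_ge0// ltW.
by rewrite ler_peMl ?rad_ge0//; have := A36; lra.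
Qed.

Lemma le_pot_rad f u K x : (forall y, 0 <= f y) ->
  (forall y, u y - avg u y <= f y) -> 0 <= K ->
  (forall y, u y <= K * (rho A y)^-1) -> ((u x)%:E <= pot f x)%E.
Proof.
move=> f0 fu K0 uK; apply: (le_pot f0 fu w_ge0 (pot_w x)) => // e e0.
have [C hC] := rho_inv_small K0 e0; exists C => y.
exact: le_trans (uK y) (hC y).
Qed.

Lemma pot_rad_ge m x : (0 < m <= d)%N ->
  ((rho A x ^- m)%:E <=
   (d%:R * d%:R + d%:R * d.+2%:R + 1)%:E * pot (fun y => rho A y ^- m.+2)%R x)%E.
Proof.
move=> /andP[m0 md].
have c0 : 0 <= d%:R * d%:R + d%:R * d.+2%:R + 1 :> R by rewrite !addr_ge0// mulr_ge0.
rewrite -potZ//; last by move=> y; exact: rad_ge0.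
apply: (@le_pot_rad _ (fun y => rho A y ^- m) 1) => // [y|y|y].
- by rewrite mulr_ge0 ?rad_ge0.
- exact: rad_laplacian_le.
rewrite mul1r; have r1 := rho_ge1 y (lexx A); have r0 := rho_gt0 y (lexx A).
by rewrite lef_pV2 ?posrE ?exprn_gt0// ler_eXnr.
Qed.

End radial_estimates.

(** * Two-sided bounds on the Green's function *)

Section green_function.
Context (R : realType) (d : nat).
Hypothesis d3 : (2 < d)%N.
Implicit Types (x y : lattice d) (B : R) (f g u w : lattice d -> R).

Definition delta0 x : R := (x == 0)%:R.

Definition heat n : lattice d -> R := iter n (@avg R d) delta0.

Lemma delta0_ge0 x : 0 <= delta0 x. Proof. exact: ler0n. Qed.

Lemma heat_ge0 n x : 0 <= heat n x.
Proof. by apply: iter_avg_ge0; exact: delta0_ge0. Qed.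

(** The graph distance from the origin, hence the first time at which the walk can be at [x]. *)
Definition l1norm x : nat := (\sum_(i < d) `|x ord0 i|)%N.

Lemma l1norm_le_sqnorm x : (l1norm x)%:R <= sqnorm R x.
Proof.
rewrite /l1norm /sqnorm natr_sum; apply: ler_sum => i _.
rewrite natr_absz intr_norm -real_normK ?num_real//.
set a := `|_|; have : a = 0 \/ 1 <= a.
  rewrite /a -intr_norm; have [->|z0] := eqVneq (x ord0 i) 0; first by left.
  by right; rewrite ler1z -gtz0_ge1 normr_gt0.
by case=> [->|]; [rewrite expr0n|nra].
Qed.

(** Follow one shortest path: moving a nonzero coordinate towards 0 lowers the distance by one and
    costs a factor [1 / (2d)]. *)
Lemma heat_ge x : (2 * d)%:R^-1 ^+ l1norm x <= heat (l1norm x) x.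
Proof.
move En : (l1norm x) => n; elim: n x En => [|n IH] x xn.
  have x0 : x = 0.
    apply/rowP => i; rewrite mxE; apply/eqP; rewrite -absz_eq0 -leqn0.
    have : (`|x ord0 i| <= l1norm x)%N by rewrite /l1norm (bigD1 i)//= leq_addr.
    by rewrite xn.
  by rewrite /heat /= /delta0 x0 eqxx.
have /existsP[i xi] : [exists i, x ord0 i != 0].
  apply: contraPT xn => /existsPn h; rewrite /l1norm big1// => i _.
  by apply/eqP; rewrite absz_eq0; have := h i; rewrite negbK.
pose b := 0 < x ord0 i.
have xn' : l1norm (x - step (i, b)) = n.
  apply/eqP; rewrite -eqSS -xn /l1norm (bigD1 i)//= [in X in _ == X](bigD1 i)//= -addSn.
  apply/eqP; congr addn.
    by rewrite /step /b /=; case: ltrP => h; rewrite !mxE !eqxx/=; lia.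
  apply: eq_bigr => j ji; rewrite /step.
  by case: b => /=; rewrite !mxE (negbTE ji) andbF ?oppr0 subr0.
rewrite exprS /heat /= ler_wpM2l ?invr_ge0//.
rewrite (bigD1 (i, b))//= -[leLHS]addr0 lerD//; first exact: IH.
by apply: sumr_ge0 => e _; exact: heat_ge0.
Qed.

Let d0 : (0 < d)%N. Proof. by apply: leq_trans d3. Qed.

(** Averaging [f] removes the term of index 0 from the series of its potential. *)
Lemma pot_avg_le f x : (forall y, 0 <= f y) -> (pot (avg f) x <= pot f x)%E.
Proof.
move=> f0; apply: lime_le.
  by apply: is_cvg_nneseries => n _ _; rewrite lee_fin iter_avg_ge0//; exact: avg_ge0.
apply: nearW => n.
apply: le_trans (_ : (\sum_(0 <= k < n.+1) (iter k (@avg R d) f x)%:E <= _)%E).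
  rewrite [leRHS]big_nat_recl//.
  rewrite (eq_bigr (fun k => (iter k.+1 (@avg R d) f x)%:E)) => [|k _].
    by apply: leeDr; rewrite lee_fin.
  by rewrite -[in LHS]iterSr.
by apply: nneseries_lim_ge => k _ _; rewrite lee_fin iter_avg_ge0.
Qed.

Lemma pot_heat_le n x : (pot (heat n) x <= pot delta0 x)%E.
Proof.
elim: n => [|n IH]; first by [].
by apply: le_trans IH; apply: pot_avg_le => y; exact: heat_ge0.
Qed.

Lemma pot_sum_heat_le n x :
  (pot (fun y => \sum_(k < n) heat k y)%R x <= n%:R%:E * pot delta0 x)%E.
Proof.
elim: n => [|n IH].
  rewrite mul0e; apply: (@pot_le_super _ _ _ (fun=> 0)) => // y; rewrite ?big_ord0//.
  by rewrite avg_cst// subr0.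
apply: le_trans (_ : pot (fun y => \sum_(k < n) heat k y)%R x + pot (heat n) x <= _)%E.
  rewrite /pot -nneseriesD; last 2 first.
  - move=> k _ _; rewrite lee_fin iter_avg_ge0// => y.
    by apply: sumr_ge0 => *; exact: heat_ge0.
  - by move=> k _ _; rewrite lee_fin iter_avg_ge0//; exact: heat_ge0.
  rewrite le_eqVlt; apply/orP; left; apply/eqP/eq_eseriesr => k _.
  rewrite -EFinD; congr EFin.
  have -> : (fun y => \sum_(i < n.+1) heat i y) =
      (fun y => 1 * (\sum_(i < n) heat i y) + 1 * heat n y).
    by apply/funext => y; rewrite big_ord_recr/= !mul1r.
  by rewrite iter_avg_lincomb !mul1r.
by rewrite -natr1 EFinD ge0_muleDl ?lee_fin// mul1e leeD// pot_heat_le.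
Qed.

Variable A : R.
Hypothesis hA : laplacian_bound d A.
Let A36 : 36 <= A. Proof. by case: hA. Qed.
Let rho1 y : 1 <= rho A y := rho_ge1 hA y (lexx A).
Let rho0 y : 0 < rho A y := rho_gt0 hA y (lexx A).

Lemma green_le m : d = m.+2 -> exists C : R, 0 < C /\
  forall x, (pot delta0 x <= (C * rho A x ^- m)%:E)%E.
Proof.
move=> dm; pose K := rho A (0 : lattice d) ^+ m.+4.
have K0 : 0 < K by rewrite exprn_gt0.
exists (K * (2 * d)%:R); split; first by rewrite mulr_gt0// ltr0n muln_gt0.
move=> x; rewrite -mulrA EFinM.
apply: (@le_trans _ _ (K%:E * pot (fun y => A * rho A y ^- m.+4)%R x)%E); last first.
  by rewrite lee_wpmul2l ?lee_fin ?(ltW K0)//; exact: (pot_rad_critical d3 hA x dm (lexx A)).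
have w0 y : 0 <= A * rho A y ^- m.+4.
  by rewrite mulr_ge0 ?rad_ge0//; have := A36; lra.
rewrite -potZ ?(ltW K0)//; apply: pot_le => y; first exact: delta0_ge0.
rewrite /delta0; have [->|_] := eqVneq y 0; last by rewrite mulr_ge0// ltW.
rewrite -/K mulrCA mulfV ?mulr1; last by rewrite gt_eqF.
by apply: le_trans A36; rewrite ler_nat.
Qed.

Lemma green_ge m : d = m.+2 -> exists c : R, 0 < c /\
  forall x, ((c * rho A x ^- m)%:E <= pot delta0 x)%E.
Proof.
move=> dm.
have m1 : (0 < m)%N by move: d3; rewrite dm.
(* The exponent [m] is critical, with a Laplacian of order [rho ^ -(m+4)] only. The exponent [m + 1]
   lies just beyond, so its term in [rho ^ -2] is negative and, at order [rho ^ -(m+3)], wins once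
   [rho > S]. *)
pose u x := rho A x ^- m + rho A x ^- m.+1 : R.
pose c1 : R := m%:R * m.+2%:R * A + A.
pose c2 : R := m.+1%:R * m.+3%:R * A + A.
have c10 : 0 <= c1 by rewrite addr_ge0 ?mulr_ge0//; have := A36; lra.
have c20 : 0 <= c2 by rewrite addr_ge0 ?mulr_ge0//; have := A36; lra.
pose S := c1 + c2.
have uf y : u y - avg u y <= S * ((rho A y <= S)%R)%:R.
  have r0 := rho0 y; have r1 := rho1 y.
  have uE : u y - avg u y = (2 * d)%:R^-1 *
     (rho A y ^- m * (rho A y ^+ m * \sum_e (rho A y ^- m - rho A (y - step e) ^- m))
    + rho A y ^- m.+1 * (rho A y ^+ m.+1 * \sum_e (rho A y ^- m.+1 - rho A (y - step e) ^- m.+1))).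
    rewrite sub_avg// /u !mulKf ?expf_neq0 ?gt_eqF// -big_split/=; congr (_ * _).
    by apply: eq_bigr => e _; ring.
  have [_ /[dup] /(_ m A y)] := hA.
  rewrite {1}dm => /(_ (leqW (leqW (leqnn m))) (lexx A)) h1.
  move=> /(_ m.+1 A y); rewrite {1}dm => /(_ (leqW (leqnn m.+1)) (lexx A)) h2.
  move: h1 h2 uE; set X1 := rho A y ^+ m * _; set X2 := rho A y ^+ m.+1 * _.
  rewrite !ler_norml => /andP[_ h1] /andP[_ h2] ->.
  have dE : d%:R - 2 - m%:R = 0 :> R by rewrite dm -[m.+2%:R]natr1 -[m.+1%:R]natr1; ring.
  have dE' : d%:R - 2 - m.+1%:R = -1 :> R by rewrite -[m.+1%:R]natr1; have := dE; lra.
  rewrite dE mulr0 mul0r add0r lerBlDl -mulrDl -/c1 in h1.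
  rewrite dE' mulrN1 in h2.
  set q := (rho A y)^-1.
  have q0 : 0 < q by rewrite invr_gt0.
  have q1 : q <= 1 by rewrite invf_le1.
  have h2' : X2 <= c2 * q ^+ 4 - q ^+ 2.
    have : m.+1%:R * q ^+ 2 >= q ^+ 2 by rewrite ler_peMl ?exprn_ge0 ?(ltW q0)// ler1n.
    by move: h2; rewrite /c2 /q !exprVn mulNr !mulrDl; lra.
  have h1' : X1 <= c1 * q ^+ 4 by rewrite /q exprVn.
  have hX : rho A y ^- m * X1 + rho A y ^- m.+1 * X2 <=
      q ^+ m.+1 * (c1 * q ^+ 3 + c2 * q ^+ 4 - q ^+ 2).
    rewrite -!exprVn -/q.
    have : q ^+ m * X1 <= q ^+ m * (c1 * q ^+ 4) by rewrite ler_wpM2l ?exprn_ge0 ?(ltW q0).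
    have : q ^+ m.+1 * X2 <= q ^+ m.+1 * (c2 * q ^+ 4 - q ^+ 2).
      by rewrite ler_wpM2l ?exprn_ge0 ?(ltW q0).
    by rewrite !exprS; lra.
  have qm0 : 0 < q ^+ m.+1 by rewrite exprn_gt0.
  have D0 : 0 < (2 * d)%:R^-1 :> R by rewrite invr_gt0 ltr0n muln_gt0.
  have D1 : (2 * d)%:R^-1 <= 1 :> R by rewrite invf_le1 ?ltr0n ?ler1n ?muln_gt0.
  have q2 : 0 < q ^+ 2 by rewrite exprn_gt0.
  have q21 : q ^+ 2 <= 1 by rewrite exprn_ile1// ltW.
  have [hS|hS] := lerP (rho A y) S; rewrite /= ?mulr1n ?mulr0n ?mulr1 ?mulr0; last first.
    rewrite pmulr_rle0//; apply: le_trans hX _; rewrite pmulr_rle0//.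
    have qS : S * q <= 1 by rewrite ler_pdivrMr// mul1r ltW.
    rewrite (_ : _ - _ = q ^+ 2 * (c1 * q + c2 * q ^+ 2 - 1)); last by ring.
    rewrite pmulr_rle0//; move: qS; rewrite /S mulrDl.
    have : c2 * q ^+ 2 <= c2 * q by rewrite ler_wpM2l// expr2 ler_piMl// ltW.
    by lra.
  apply: le_trans (_ : (2 * d)%:R^-1 * S <= _); last first.
    by rewrite ler_piMl// /S addr_ge0.
  rewrite ler_pM2l//; apply: le_trans hX _.
  have q31 : q ^+ 3 <= 1 by rewrite exprn_ile1// ltW.
  have q41 : q ^+ 4 <= 1 by rewrite exprn_ile1// ltW.
  have qm1 : q ^+ m.+1 <= 1 by rewrite exprn_ile1// ltW.
  have hb : c1 * q ^+ 3 + c2 * q ^+ 4 - q ^+ 2 <= S.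
    have : c1 * q ^+ 3 <= c1 by rewrite ler_piMr.
    have : c2 * q ^+ 4 <= c2 by rewrite ler_piMr.
    by rewrite /S; lra.
  apply: le_trans (_ : q ^+ m.+1 * S <= _); first by rewrite ler_pM2l.
  by rewrite ler_piMl// addr_ge0.
have S0 : 0 <= S by rewrite addr_ge0.
(* A point with [rho <= S] is at graph distance at most [S ^ 2 < J], so one of the first [J] heat
   kernels is at least [(2 * d) ^ -J] there; [C] compensates this factor. *)
pose J := Num.bound (S ^+ 2).
have SJ : S ^+ 2 < J%:R by apply: archi_boundP; rewrite exprn_ge0.
pose C := S * (2 * d)%:R ^+ J.
have C0 : 0 <= C by rewrite mulr_ge0// exprn_ge0.
have fC y : S * ((rho A y <= S)%R)%:R <= C * \sum_(k < J) heat k y.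
  have sh : 0 <= \sum_(k < J) heat k y by apply: sumr_ge0 => k _; exact: heat_ge0.
  have [hS|hS] := lerP (rho A y) S; rewrite /= ?mulr1n ?mulr0n ?mulr1 ?mulr0 ?mulr_ge0//.
  have nJ : (l1norm y < J)%N.
    rewrite -(ltr_nat R); apply: le_lt_trans SJ; apply: le_trans (l1norm_le_sqnorm y) _.
    apply: le_trans (_ : rho A y ^+ 2 <= _); last by rewrite lerXn2r// nnegrE// ltW.
    by rewrite sqr_rho; have := A36; lra.
  rewrite /C -mulrA ler_peMr// (bigD1 (Ordinal nJ))//= mulrDr.
  have : 0 <= (2 * d)%:R ^+ J * (\sum_(i < J | i != Ordinal nJ) heat i y).
    by rewrite mulr_ge0 ?exprn_ge0// sumr_ge0// => k _; exact: heat_ge0.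
  have : 1 <= (2 * d)%:R ^+ J * heat (l1norm y) y; last by lra.
  apply: le_trans (_ : (2 * d)%:R ^+ J * (2 * d)%:R^-1 ^+ l1norm y <= _); last first.
    by rewrite ler_wpM2l ?exprn_ge0// heat_ge.
  rewrite exprVn -expfB// exprn_ege1// ler1n muln_gt0//.
have J0 : 0 < J%:R :> R by apply: le_lt_trans SJ; rewrite exprn_ge0.
have upot x : ((u x)%:E <= (C * J%:R)%:E * pot delta0 x)%E.
  apply: le_trans (_ : pot (fun y => C * \sum_(k < J) heat k y)%R x <= _)%E.
    apply: (@le_pot_rad _ _ d3 A hA _ _ 2) => // [y|y|y].
    - by rewrite mulr_ge0// sumr_ge0// => k _; exact: heat_ge0.
    - exact: le_trans (uf y) (fC y).
    - have -> : 2 * (rho A y)^-1 = (rho A y)^-1 + (rho A y)^-1 by ring.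
      by rewrite /u lerD// lef_pV2 ?posrE ?exprn_gt0// ler_eXnr.
  rewrite potZ//; last by move=> y; apply: sumr_ge0 => k _; exact: heat_ge0.
  rewrite (EFinM C J%:R) -muleA; apply: lee_wpmul2l; first by rewrite lee_fin.
  exact: pot_sum_heat_le.
exists (C * J%:R + 1)^-1.
have CJ : 0 < C * J%:R + 1 by rewrite ltr_wpDl// mulr_ge0.
split; first by rewrite invr_gt0.
move=> x; rewrite EFinM lee_pdivrMl//.
apply: le_trans (_ : (u x)%:E <= _)%E; first by rewrite lee_fin lerDl rad_ge0.
apply: le_trans (upot x) _; rewrite lee_wpmul2r ?lee_fin ?lerDl//.
by apply: pot_ge0; exact: delta0_ge0.
Qed.

End green_function.

(** * Convolution algebra on the lattice and heat kernels *)

Section convolution_theory.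
Local Open Scope ereal_scope.
Context (R : realType) (d : nat).
Implicit Types (f g h : lattice d -> \bar R) (x y : lattice d).

Lemma bijective_addr x : bijective (fun y : lattice d => y + x)%R.
Proof. by exists (fun y => y - x)%R => y; rewrite ?addrK ?subrK. Qed.

Lemma bijective_subl x : bijective (fun y : lattice d => x - y)%R.
Proof. by exists (fun y => x - y)%R => y; rewrite subKr. Qed.

Lemma convolution_ge0 f g x : (forall y, 0 <= f y) -> (forall y, 0 <= g y) ->
  0 <= convolution f g x.
Proof. by move=> f0 g0; apply: esum_ge0 => y _; rewrite mule_ge0. Qed.

Lemma convolution_le f f' g g' x : (forall y, 0 <= f y) -> (forall y, 0 <= g y) ->
  (forall y, f y <= f' y) -> (forall y, g y <= g' y) ->
  convolution f g x <= convolution f' g' x.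
Proof. by move=> f0 g0 ff gg; apply: le_esum => y _; rewrite lee_pmul. Qed.

Lemma convolutionC f g : convolution f g = convolution g f.
Proof.
apply/funext => x; rewrite /convolution (reindex_esumT _ (bijective_subl x)).
by apply: eq_esum => y _; rewrite subKr muleC.
Qed.

Lemma convolutionA f g h : (forall y, 0 <= f y) -> (forall y, 0 <= g y) ->
  (forall y, 0 <= h y) ->
  convolution (convolution f g) h = convolution f (convolution g h).
Proof.
move=> f0 g0 h0; apply/funext => x; rewrite /convolution.
transitivity (\esum_(y in [set: lattice d]) \esum_(z in [set: lattice d])
    (f z * (g (y - z)%R * h (x - y)%R))).
  apply: eq_esum => y _; rewrite muleC -esumZl//; last by move=> z; rewrite mule_ge0.
  by apply: eq_esum => z _; rewrite muleC -muleA.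
rewrite esum_exchange; last by move=> *; rewrite !mule_ge0.
apply: eq_esum => z _; rewrite esumZl//; last by move=> y; rewrite mule_ge0.
congr (_ * _); rewrite (reindex_esumT _ (bijective_addr z)).
by apply: eq_esum => y _; rewrite addrK opprD addrA addrAC.
Qed.

Lemma convolution_even f g : (forall x, f (- x)%R = f x) ->
  (forall x, g (- x)%R = g x) -> forall x, convolution f g (- x)%R = convolution f g x.
Proof.
move=> fe ge x; rewrite /convolution (reindex_esumT _ (bijective_subl 0%R)).
by apply: eq_esum => y _; rewrite sub0r fe opprK -ge opprD opprK.
Qed.

Definition edelta x : \bar R := (delta0 R x)%:E.

Lemma edelta_ge0 x : 0 <= edelta x.
Proof. by rewrite lee_fin delta0_ge0. Qed.

Lemma convolution_delta f : (forall y, 0 <= f y) -> convolution edelta f = f.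
Proof.
move=> f0; apply/funext => x; rewrite /convolution (@esum_only _ _ 0%R).
- by rewrite /edelta /delta0 eqxx mul1e subr0.
- by rewrite mule_ge0 ?edelta_ge0.
- by move=> y /negbTE y0; rewrite /edelta /delta0 y0 mul0e.
Qed.

(* [conv_pow] with the value at exponent 0 that makes it additive. *)
Definition conv_pow0 g k : lattice d -> \bar R :=
  if k is 0%N then edelta else conv_pow g k.

Lemma conv_powE g k : (0 < k)%N -> conv_pow0 g k = conv_pow g k.
Proof. by case: k. Qed.

Lemma conv_pow0S g k : (forall x, 0 <= g x) ->
  conv_pow0 g k.+1 = convolution (conv_pow0 g k) g.
Proof. by case: k => [|k] g0 //=; rewrite convolution_delta. Qed.

Lemma conv_pow0_ge0 g k x : (forall x, 0 <= g x) -> 0 <= conv_pow0 g k x.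
Proof.
move=> g0; elim: k x => [|k IH] x; first exact: edelta_ge0.
by rewrite conv_pow0S// convolution_ge0.
Qed.

Lemma conv_pow0D g k l : (forall x, 0 <= g x) ->
  convolution (conv_pow0 g k) (conv_pow0 g l) = conv_pow0 g (k + l).
Proof.
move=> g0; have p0 m x : 0 <= conv_pow0 g m x by exact: conv_pow0_ge0.
elim: l => [|l IH]; first by rewrite addn0 convolutionC convolution_delta.
by rewrite addnS !conv_pow0S// -IH -convolutionA.
Qed.

Lemma conv_pow0_even g k : (forall x, 0 <= g x) -> (forall x, g (- x)%R = g x) ->
  forall x, conv_pow0 g k (- x)%R = conv_pow0 g k x.
Proof.
move=> g0 ge; elim: k => [|k IH] x; first by rewrite /= /edelta /delta0 oppr_eq0.
by rewrite conv_pow0S// convolution_even.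
Qed.

Lemma esum_heat (f : lattice d -> R) n x : (forall y, (0 <= f y)%R) ->
  \esum_(y in [set: lattice d]) (f y * heat R n (x - y))%:E =
  (iter n (@avg R d) f x)%:E.
Proof.
move=> f0; elim: n x => [|n IH] x.
  rewrite (@esum_only _ _ x) /heat /delta0 /= ?subrr ?eqxx ?mulr1n ?mulr1//.
    by rewrite lee_fin.
  by move=> y; rewrite subr_eq0 eq_sym => /negbTE ->; rewrite mulr0.
transitivity (\esum_(y in [set: lattice d])
    ((2 * d)%:R^-1%:E * \sum_e (f y * heat R n ((x - step e) - y))%:E)).
  apply: eq_esum => y _; rewrite sumEFin -EFinM; congr EFin.
  rewrite /heat /= {1}/avg mulrCA; congr (_ * _)%R; rewrite mulr_sumr.
  by apply: eq_bigr => e _; rewrite addrAC.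
rewrite esumZl; last 2 first.
- by rewrite lee_fin invr_ge0.
- by move=> y; apply: sume_ge0 => e _; rewrite lee_fin mulr_ge0 ?heat_ge0.
rewrite esum_sum; last by move=> y e _ _; rewrite lee_fin mulr_ge0 ?heat_ge0.
by under eq_bigr do rewrite IH; rewrite sumEFin -EFinM.
Qed.

(** The heat kernel at time [n] is the kernel of [avg ^ n]; exchanging the sums over sites and times
    does the rest. *)
Lemma convolution_pot (f : lattice d -> R) : (forall y, (0 <= f y)%R) ->
  convolution (fun y => (f y)%:E) (pot (@delta0 R d)) = pot f.
Proof.
move=> f0; apply/funext => x; rewrite /convolution.
transitivity (\esum_(y in [set: lattice d]) \esum_(n in [set: nat])
    (f y * heat R n (x - y))%:E).
  apply: eq_esum => y _; rewrite /pot nneseries_esumT; last first.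
    by move=> n; rewrite lee_fin heat_ge0.
  by rewrite -esumZl ?lee_fin// => n; rewrite lee_fin heat_ge0.
rewrite esum_exchange; last by move=> *; rewrite lee_fin mulr_ge0 ?heat_ge0.
rewrite /pot nneseries_esumT; last by move=> n; rewrite lee_fin iter_avg_ge0.
by apply: eq_esum => n _; rewrite esum_heat.
Qed.

Lemma heat_even n x : heat R n (- x)%R = heat R n x.
Proof.
elim: n x => [|n IH] x; first by rewrite /heat /= /delta0 oppr_eq0.
rewrite /heat /= /avg; congr (_ * _)%R.
rewrite (reindex_inj (h := fun e : 'I_d * bool => (e.1, ~~ e.2))); last first.
  by move=> [i b] [j c] [-> /negb_inj ->].
apply: eq_bigr => -[i b] _ /=; rewrite -[LHS]IH; congr (iter _ _ _ _).
by rewrite /step /=; case: b => /=; rewrite opprD !opprK.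
Qed.

End convolution_theory.

(** * Two-sided bounds on the convolution powers of the Green's function *)

Section green_powers.
Local Open Scope ereal_scope.
Context (R : realType) (d : nat).
Hypothesis d3 : (2 < d)%N.

Local Notation gr := (pot (@delta0 R d)).
Local Notation G := (conv_pow0 gr).

Lemma gr_ge0 x : 0 <= gr x.
Proof. by apply: pot_ge0; exact: delta0_ge0. Qed.

Lemma gr_even x : gr (- x)%R = gr x.
Proof. by apply: eq_eseriesr => n _; rewrite -!/(heat R n _) heat_even. Qed.

Let G0 k x : 0 <= G k x. Proof. by apply: conv_pow0_ge0; exact: gr_ge0. Qed.

Lemma convolution_gr (c : R) (f : lattice d -> R) x : (0 <= c)%R -> (forall y, (0 <= f y)%R) ->
  convolution (fun y => (c * f y)%:E) gr x = c%:E * pot f x.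
Proof.
move=> c0 f0; rewrite convolution_pot; last by move=> y; rewrite mulr_ge0.
by rewrite potZ.
Qed.

Variable A : R.
Hypothesis hA : laplacian_bound d A.
Let A36 : (36 <= A)%R. Proof. by case: hA. Qed.

(** Each further convolution with [gr] lowers the decay exponent by 2. The condition [2 * k < d]
    keeps it positive, so the truncated subtraction is exact and the subcritical estimate
    applies. *)
Lemma conv_pow_le k : (0 < k)%N -> (2 * k < d)%N -> exists C : R, (0 < C)%R /\
  forall x, G k x <= (C * rho A x ^- (d - 2 * k))%:E.
Proof.
elim: k => // -[|k] IH _ kd.
  have dE : d = (d - 2 * 1).+2 by lia.
  by have [C [C0 hC]] := green_le d3 hA dE; exists C.
have [C [C0 hC]] := IH isT ltac:(lia).
exists (C * (2 * d)%:R)%R; split; first by rewrite mulr_gt0// ltr0n; lia.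
move=> x; rewrite conv_pow0S; last exact: gr_ge0.
apply: le_trans (_ : convolution (fun y => (C * rho A y ^- (d - 2 * k.+1))%:E) gr x <= _).
  by apply: convolution_le => // y; exact: gr_ge0.
rewrite convolution_gr ?(ltW C0)//; last by move=> y; exact: rad_ge0.
rewrite -mulrA EFinM; apply: lee_wpmul2l; first by rewrite lee_fin ltW.
have -> : (d - 2 * k.+1 = (d - 2 * k.+2).+2)%N by lia.
by apply: (pot_rad_subcritical d3 hA) => //; lia.
Qed.

Lemma conv_pow_ge k : (0 < k)%N -> (2 * k < d)%N -> exists c : R, (0 < c)%R /\
  forall x, (c * rho A x ^- (d - 2 * k))%:E <= G k x.
Proof.
elim: k => // -[|k] IH _ kd.
  have dE : d = (d - 2 * 1).+2 by lia.
  by have [C [C0 hC]] := green_ge d3 hA dE; exists C.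
have [c [c0 hc]] := IH isT ltac:(lia).
pose K : R := (d%:R * d%:R + d%:R * d.+2%:R + 1)%R.
have K0 : (0 < K)%R by rewrite ltr_wpDl// addr_ge0// mulr_ge0.
exists (c / K)%R; split; first by rewrite divr_gt0.
move=> x; rewrite conv_pow0S; last exact: gr_ge0.
apply: le_trans
  (_ : convolution (fun y => (c * rho A y ^- (d - 2 * k.+1))%:E) gr x <= _); last first.
  apply: convolution_le => // y; last exact: gr_ge0.
  by rewrite lee_fin mulr_ge0 ?rad_ge0 ?ltW.
rewrite convolution_gr ?(ltW c0)//; last by move=> y; exact: rad_ge0.
rewrite -mulrA EFinM; apply: lee_wpmul2l; first by rewrite lee_fin ltW.
have -> : (d - 2 * k.+1 = (d - 2 * k.+2).+2)%N by lia.
rewrite EFinM lee_pdivrMl//.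
by apply: (pot_rad_ge d3 hA) => //; lia.
Qed.

(* Volume growth of [G N], in the smoothed form provided by the critical test
   function; at [x = 0] it says that [G N] has mass [O(r ^ 2N)] on a ball of
   radius [r = sqrt B]. *)
Lemma conv_pow_bump k : (0 < k)%N -> (2 * k < d)%N -> exists C : R, (0 < C)%R /\
  forall B x, (A <= B)%R ->
  convolution (G k) (fun y => (B * rho B y ^- d.+2)%:E) x
    <= (C * rho B x ^- (d - 2 * k))%:E.
Proof.
have w0 B (y : lattice d) : (A <= B)%R -> (0 <= B * rho B y ^- d.+2)%R.
  by move=> AB; rewrite mulr_ge0 ?rad_ge0//; have := A36; lra.
elim: k => // -[|k] IH _ kd.
  have dE : d = (d - 2 * 1).+2 by lia.
  have dE4 : d.+2 = (d - 2 * 1).+4 by lia.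
  exists (2 * d)%:R%R; split; first by rewrite ltr0n; lia.
  move=> B x AB; rewrite convolutionC convolution_pot; last by move=> y; exact: w0.
  by rewrite dE4; apply: (pot_rad_critical d3 hA).
have [C [C0 hC]] := IH isT ltac:(lia).
exists (C * (2 * d)%:R)%R; split; first by rewrite mulr_gt0// ltr0n; lia.
move=> B x AB; rewrite conv_pow0S; last exact: gr_ge0.
(* The factors are reordered so that the extra [gr] acts last, on the bound that the induction
   hypothesis gives for [G k.+1] convolved with the bump. *)
rewrite (convolutionC (G _)) convolutionA//; last 2 first.
- exact: gr_ge0.
- by move=> y; rewrite lee_fin w0.
rewrite convolutionC.
apply: le_trans (_ : convolution (fun y => (C * rho B y ^- (d - 2 * k.+1))%:E) gr x <= _).
  apply: convolution_le => // y; [|exact: gr_ge0|exact: hC].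
  by apply: convolution_ge0 => // u; rewrite lee_fin w0.
rewrite convolution_gr ?(ltW C0)//; last by move=> y; exact: rad_ge0.
rewrite -mulrA EFinM; apply: lee_wpmul2l; first by rewrite lee_fin ltW.
have -> : (d - 2 * k.+1 = (d - 2 * k.+2).+2)%N by lia.
by apply: (pot_rad_subcritical d3 hA) => //; lia.
Qed.

End green_powers.

(** * Sums of products of three Green's functions *)

Section three_green.
Local Open Scope ereal_scope.
Context (R : realType) (d : nat).
Implicit Types (x y z a b : lattice d).

Lemma sqnormN x : sqnorm R (- x)%R = sqnorm R x.
Proof. by apply: eq_bigr => i _; rewrite mxE intrN sqrrN. Qed.

Lemma sqnormD_le x y : (sqnorm R (x + y) <= 2 * sqnorm R x + 2 * sqnorm R y)%R.
Proof.
rewrite /sqnorm !mulr_sumr -big_split; apply: ler_sum => i _ /=.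
rewrite mxE intrD; set p := _%:~R; set q := _%:~R.
by have := sqr_ge0 (p - q)%R; lra.
Qed.

(** The uneven weights come from [(p + 2q) ^ 2 >= 0]. They matter when [|x| <= |z| / 2]: doubled,
    the first term is [3 |x| ^ 2 <= 3/4 |z| ^ 2], whereas equal weights 2 could use up all of
    [|z| ^ 2]. *)
Lemma sqnormB_le x y : (sqnorm R (x - y) <= 3 / 2 * sqnorm R x + 3 * sqnorm R y)%R.
Proof.
rewrite /sqnorm !mulr_sumr -big_split; apply: ler_sum => i _ /=.
rewrite !mxE intrB; set p := _%:~R; set q := _%:~R.
by have := sqr_ge0 (p + 2 * q)%R; lra.
Qed.

Lemma rho_le (K B B' : R) x y : (0 <= K)%R ->
  (B' + sqnorm R x <= K ^+ 2 * (B + sqnorm R y))%R -> (rho B' x <= K * rho B y)%R.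
Proof.
move=> K0 h; rewrite /rho.
have -> : K = Num.sqrt (K ^+ 2) by rewrite sqrtr_sqr ger0_norm.
by rewrite -sqrtrM ?sqr_ge0// ler_wsqrtr.
Qed.

Lemma exprV_le (K r s : R) j : (0 <= K)%R -> (0 < r)%R -> (0 < s)%R -> (r <= K * s)%R ->
  (s ^- j <= K ^+ j * r ^- j)%R.
Proof.
move=> K0 r0 s0 h; rewrite -!exprVn -exprMn; apply: lerXn2r.
- by rewrite nnegrE invr_ge0 ltW.
- by rewrite nnegrE mulr_ge0// invr_ge0 ltW.
- by rewrite ler_pdivlMr// mulrC ler_pdivrMr.
Qed.

Hypothesis d3 : (2 < d)%N.
Local Notation gr := (pot (@delta0 R d)).
Local Notation G := (conv_pow0 gr).

Let G0 k x : 0 <= G k x. Proof. by apply: conv_pow0_ge0; exact: gr_ge0. Qed.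
Let Gev k x : G k (- x)%R = G k x.
Proof. by apply: conv_pow0_even; [exact: gr_ge0|exact: gr_even]. Qed.

Lemma esum_green_pair k l (u v : lattice d) :
  \esum_(w in [set: lattice d]) (G k (u - w)%R * G l (v - w)%R) = G (k + l) (u - v)%R.
Proof.
rewrite -conv_pow0D; last exact: gr_ge0.
rewrite /convolution (reindex_esumT _ (bijective_subl u)).
apply: eq_esum => w _; rewrite subKr -[G l (v - _)%R]Gev; congr (_ * G l _).
by rewrite opprB addrAC.
Qed.

Lemma esum_green_triple k l : (0 < k)%N -> (0 < l)%N -> (2 * (k + l) < d)%N ->
  exists C : R, (0 < C)%R /\ forall z a b,
  (4 * sqnorm R a <= sqnorm R z)%R -> (4 * sqnorm R b <= sqnorm R z)%R ->
  \esum_(w in [set: lattice d])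
     (G (k + l) w * (G k (a - z - w)%R * G l (b - z - w)%R))
    <= C%:E * (G (k + l) (z - a)%R * G (k + l) (a - b)%R).
Proof.
move=> k0 l0 kld; have [A hA] := laplacian_bound_exists R d.
have A36 : (36 <= A)%R by case: hA.
have r0 B (x : lattice d) : (A <= B)%R -> (0 < rho B x)%R by move=> AB; apply: (rho_gt0 hA).
have [Ck [Ck0 hCk]] := conv_pow_le d3 hA k0 ltac:(lia).
have [Cl [Cl0 hCl]] := conv_pow_le d3 hA l0 ltac:(lia).
have kl0 : (0 < k + l)%N by lia.
have [Cn [Cn0 hCn]] := conv_pow_le d3 hA kl0 kld.
have [cn [cn0 hcn]] := conv_pow_ge d3 hA kl0 kld.
have [Cb [Cb0 hCb]] := conv_pow_bump d3 hA kl0 kld.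
(* This balance of exponents is what makes the region of small [w] work: the two factors of order
   [|z| ^ -(d-2k)] and [|z| ^ -(d-2l)] give [|z| ^ -j] times the inverse volume [|z| ^ -d]. *)
have jd : (d - 2 * (k + l) + d = (d - 2 * k) + (d - 2 * l))%N by lia.
set j := (d - 2 * (k + l))%N in hCn hcn hCb jd.
(* In the far region [|z - a| ^ 2 <= 9/4 |z| ^ 2 <= 108 |w| ^ 2 <= 14 ^ 2 |w| ^ 2]. In [C2], the 4
   is the ratio in [low] and the 2 compares [rho B w] with [rho A z]. In [C3], the 2 comes from
   [rza] and the two divisions by [cn] from the lower bound on [G]. *)
pose C1 := (Cn * 14 ^+ j / cn)%R.
pose C2 := (Ck * 4 ^+ (d - 2 * k) * (Cl * 4 ^+ (d - 2 * l)) * 2 ^+ d.+2)%R.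
pose C3 := (C2 * Cb * 2 ^+ j / cn / cn)%R.
have C10 : (0 < C1)%R by rewrite !mulr_gt0 ?exprn_gt0 ?invr_gt0.
have C20 : (0 < C2)%R by do ![apply: mulr_gt0 => // | apply: exprn_gt0 => //].
have C30 : (0 < C3)%R.
  by do 2![apply: divr_gt0 => //]; do 2![apply: mulr_gt0 => //]; apply: exprn_gt0.
exists (C1 + C3)%R; split; first exact: addr_gt0.
move=> z a b az bz.
pose B := (A + sqnorm R z)%R.
have sz0 := @sqnorm_ge0 R d z.
have AB : (A <= B)%R by rewrite lerDl.
have rz0 := r0 A z (lexx A).
have rza : (rho A (z - a) <= 2 * rho A z)%R.
  apply: rho_le => //; have := sqnormB_le z a; have := @sqnorm_ge0 R d a; lra.
have rab : (rho A (a - b) <= 1 * rho A z)%R.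
  by apply: rho_le => //; have := sqnormD_le a (- b)%R; rewrite sqnormN; lra.
(* Up to constants, the indicator of the ball of radius [|z|] divided by its volume, with a smooth
   tail. The choice of [B] gives [B = rho A z ^ 2]. *)
pose psi (w : lattice d) : R := (B * rho B w ^- d.+2)%R.
have psi0 w : (0 <= psi w)%R.
  by rewrite mulr_ge0 ?rad_ge0//; lra.
(* The bounds for the far and near regions are added pointwise, so each can be summed over the whole
   lattice. *)
have pt w : G (k + l) w * (G k (a - z - w)%R * G l (b - z - w)%R) <=
   C1%:E * G (k + l) (z - a)%R * (G k (a - z - w)%R * G l (b - z - w)%R)
   + (C2 * rho A z ^- j)%:E * (G (k + l) w * (psi w)%:E).
  have [far|near] := lerP (sqnorm R z) (48 * sqnorm R w).
    apply: le_trans (_ : C1%:E * G (k + l) (z - a)%R *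
        (G k (a - z - w)%R * G l (b - z - w)%R) <= _); last first.
      rewrite leeDl//; apply: mule_ge0; last by apply: mule_ge0; rewrite ?lee_fin.
      by rewrite lee_fin mulr_ge0 ?rad_ge0// ltW.
    apply: lee_wpmul2r; first by rewrite mule_ge0.
    apply: le_trans (hCn w) _.
    apply: le_trans (_ : (C1 * (cn * rho A (z - a) ^- j))%:E <= _); last first.
      by rewrite EFinM; apply: lee_wpmul2l => //; rewrite lee_fin ltW.
    rewrite lee_fin /C1 -mulrA mulrA mulrA mulfVK ?gt_eqF// -mulrA ler_pM2l//.
    apply: exprV_le => //; try exact: r0.
    apply: rho_le => //; have := sqnormB_le z a; have := @sqnorm_ge0 R d w; lra.
  apply: le_trans (_ : (C2 * rho A z ^- j)%:E * (G (k + l) w * (psi w)%:E) <= _); last first.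
    rewrite leeDr//; apply: mule_ge0; last exact: mule_ge0.
    by apply: mule_ge0; rewrite ?lee_fin ?(ltW C10).
  rewrite [leRHS]muleCA; apply: lee_wpmul2l => //.
  (* The constant 48 is small enough for this: [|z| ^ 2] is at most
     [2 |c-z-w| ^ 2 + 2 (3/2 |c| ^ 2 + 3 |w| ^ 2)]. *)
  have low c : (4 * sqnorm R c <= sqnorm R z)%R -> (rho A z <= 4 * rho A (c - z - w))%R.
    move=> cz; apply: rho_le => //.
    have := sqnormD_le (z + w - c)%R (c - w)%R; have := sqnormB_le c w.
    rewrite [(_ - c + _)%R]addrA subrK addrK -(sqnormN (z + w - c)%R) opprB opprD addrA.
    lra.
  apply: le_trans (_ : (Ck * rho A (a - z - w) ^- (d - 2 * k))%:E *
                       (Cl * rho A (b - z - w) ^- (d - 2 * l))%:E <= _).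
    by apply: lee_pmul.
  rewrite -!EFinM lee_fin.
  have psiw : (rho A z ^- d <= 2 ^+ d.+2 * psi w)%R.
    rewrite /psi mulrCA.
    have Br : (B = rho A z ^+ 2)%R by rewrite sqr_rho//; lra.
    have : (rho A z ^- d.+2 <= 2 ^+ d.+2 * rho B w ^- d.+2)%R.
      apply: exprV_le => //; first exact: r0.
      by apply: rho_le => //; rewrite /B; have := @sqnorm_ge0 R d w; lra.
    rewrite -(ler_pM2l (_ : 0 < B)%R); last by lra.
    apply: le_trans.
    by rewrite {1}Br -[d.+2]add2n exprD invfM mulVKf// expf_neq0// gt_eqF.
  have hk : (rho A (a - z - w) ^- (d - 2 * k) <= 4 ^+ (d - 2 * k) * rho A z ^- (d - 2 * k))%R.
    by apply: exprV_le => //; [exact: r0|exact: low].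
  have hl : (rho A (b - z - w) ^- (d - 2 * l) <= 4 ^+ (d - 2 * l) * rho A z ^- (d - 2 * l))%R.
    by apply: exprV_le => //; [exact: r0|exact: low].
  apply: le_trans (_ : (Ck * (4 ^+ (d - 2 * k) * rho A z ^- (d - 2 * k))) *
    (Cl * (4 ^+ (d - 2 * l) * rho A z ^- (d - 2 * l))) <= _)%R.
    by apply: ler_pM; rewrite ?mulr_ge0 ?rad_ge0 ?(ltW Ck0) ?(ltW Cl0)// ler_pM2l.
  have -> : (Ck * (4 ^+ (d - 2 * k) * rho A z ^- (d - 2 * k)) *
    (Cl * (4 ^+ (d - 2 * l) * rho A z ^- (d - 2 * l))) =
    Ck * 4 ^+ (d - 2 * k) * (Cl * 4 ^+ (d - 2 * l)) * (rho A z ^- j * rho A z ^- d))%R.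
    rewrite -[(rho A z ^- j * _)%R]invfM -exprD.
    by rewrite jd exprD invfM; ring.
  have -> : (C2 * rho A z ^- j * psi w = Ck * 4 ^+ (d - 2 * k) * (Cl * 4 ^+ (d - 2 * l)) *
      (rho A z ^- j * (2 ^+ d.+2 * psi w)))%R by rewrite /C2; ring.
  rewrite ler_pM2l; last by do ![apply: mulr_gt0 => // | apply: exprn_gt0 => //].
  by rewrite ler_wpM2l// rad_ge0.
apply: le_trans (le_esum (fun w _ => pt w)) _.
rewrite esumD; last 2 first.
- move=> w _; apply: mule_ge0; last exact: mule_ge0.
  by apply: mule_ge0; rewrite ?lee_fin ?(ltW C10).
- move=> w _; apply: mule_ge0; first by rewrite lee_fin mulr_ge0 ?rad_ge0// ltW.
  by apply: mule_ge0; rewrite ?lee_fin.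
rewrite EFinD ge0_muleDl ?lee_fin ?(ltW C10) ?(ltW C30)//.
apply: leeD.
  rewrite esumZl; last 2 first.
  - by rewrite mule_ge0 ?lee_fin ?(ltW C10).
  - by move=> w; rewrite mule_ge0.
  rewrite esum_green_pair -muleA.
  by rewrite (_ : a - z - (b - z) = a - b)%R// opprB addrA subrK.
rewrite esumZl; last 2 first.
- by rewrite lee_fin mulr_ge0 ?rad_ge0// ltW.
- by move=> w; rewrite mule_ge0 ?lee_fin.
(* As [psi] is even, the sum is a convolution at 0, where [conv_pow_bump] applies with
   [rho B 0 = rho A z]. *)
have -> : \esum_(w in [set: lattice d]) (G (k + l) w * (psi w)%:E) =
    convolution (G (k + l)) (fun w => (psi w)%:E) 0%R.
  by apply: eq_esum => w _; rewrite sub0r /psi /rho sqnormN.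
apply: le_trans (_ : (C2 * rho A z ^- j)%:E * (Cb * rho A z ^- j)%:E <= _).
  apply: lee_wpmul2l; first by rewrite lee_fin mulr_ge0 ?rad_ge0// ltW.
  apply: le_trans (hCb B 0%R AB) _.
  rewrite lee_fin ler_pM2l// /rho (_ : sqnorm R 0 = 0)%R ?addr0//.
  by rewrite /sqnorm big1// => i _; rewrite mxE expr0n.
apply: le_trans (_ : C3%:E * ((cn * rho A (z - a) ^- j)%:E * (cn * rho A (a - b) ^- j)%:E) <= _).
  rewrite -!EFinM lee_fin.
  have -> : (C2 * rho A z ^- j * (Cb * rho A z ^- j) =
     C2 * Cb * (rho A z ^- j * rho A z ^- j))%R by ring.
  have -> : (C3 * (cn * rho A (z - a) ^- j * (cn * rho A (a - b) ^- j)) =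
     C2 * Cb * ((2 ^+ j * rho A (z - a) ^- j) * (1 ^+ j * rho A (a - b) ^- j)))%R.
    rewrite /C3 expr1n; move: (rho A (z - a) ^- j)%R (rho A (a - b) ^- j)%R => p q.
    by field; rewrite gt_eqF.
  rewrite ler_pM2l; last exact: mulr_gt0.
  by apply: ler_pM; rewrite ?rad_ge0//; apply: exprV_le => //; exact: r0.
apply: lee_wpmul2l; first by rewrite lee_fin ltW.
by apply: lee_pmul; rewrite ?lee_fin ?mulr_ge0 ?rad_ge0 ?(ltW cn0).
Qed.

(** When [k] or [l] is 0, [G 0] is the delta function and a single [w] survives: [w = a - z] yields
    the term with [G (z - a)], and [w = b - z] the one with [G (z - b)]. *)
Lemma esum_green_triple_le k l : (0 < k + l)%N -> (2 * (k + l) < d)%N ->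
  exists C : R, (0 < C)%R /\ forall z a b,
  (4 * sqnorm R a <= sqnorm R z)%R -> (4 * sqnorm R b <= sqnorm R z)%R ->
  \esum_(w in [set: lattice d])
     (G (k + l) w * (G k (a - z - w)%R * G l (b - z - w)%R))
    <= C%:E * (G (k + l) (z - a)%R + G (k + l) (z - b)%R) * G (k + l) (a - b)%R.
Proof.
have only (F : lattice d -> \bar R) (u : lattice d) : (forall w, 0 <= F w) ->
    \esum_(w in [set: lattice d]) (F w * G 0 (u - w)%R) = F u.
  move=> F0; rewrite (@esum_only _ _ u).
  - by rewrite subrr /= /edelta /delta0 eqxx mule1.
  - by rewrite mule_ge0.
  - by move=> w wu; rewrite /= /edelta /delta0 subr_eq0 eq_sym (negbTE wu) mule0.
case: k => [|k]; last case: l => [|l].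
- rewrite add0n => l0 ld; exists 1%R; split => // z a b _ _.
  under eq_esum do rewrite muleCA muleC.
  rewrite only; last by move=> w; rewrite mule_ge0.
  rewrite mul1e; have -> : (b - z - (a - z) = - (a - b))%R.
    by rewrite opprB addrA subrK opprB.
  by rewrite Gev -[G l (a - z)%R]Gev opprB lee_wpmul2r// leeDl.
- rewrite addn0 => k0 kd; exists 1%R; split => // z a b _ _.
  under eq_esum do rewrite muleA.
  rewrite only; last by move=> w; rewrite mule_ge0.
  rewrite mul1e; have -> : (a - z - (b - z) = a - b)%R.
    by rewrite opprB addrA subrK.
  by rewrite -[G k.+1 (b - z)%R]Gev opprB lee_wpmul2r// leeDr.
- move=> _ kld; have [C [C0 hC]] := esum_green_triple (ltn0Sn k) (ltn0Sn l) kld.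
  exists C; split => // z a b az bz; apply: le_trans (hC z a b az bz) _.
  rewrite muleA; apply: lee_wpmul2r => //; apply: lee_wpmul2l; first by rewrite lee_fin ltW.
  by rewrite leeDl.
Qed.

End three_green.

(** * Sums over the positions of several walks *)

Section iterated_convolution.
Local Open Scope ereal_scope.
Context {R : realType} {d : nat}.
Implicit Types (u : lattice d).

(** The convolution of [n] possibly different functions, as one sum over tuples with prescribed
    total; for [n = 0] it is [edelta]. *)
Definition convn n (c : 'I_n -> lattice d -> \bar R) u : \bar R :=
  \esum_(x in [set: {ffun 'I_n -> lattice d}])
    (((\sum_i x i)%R == u)%:R%:E * \prod_(i < n) c i (x i)).

Let prode_ge0' n (F : 'I_n -> \bar R) : (forall i, 0 <= F i) -> 0 <= \prod_(i < n) F i.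
Proof. by move=> F0; apply: prode_ge0. Qed.

Lemma convn_ge0 n (c : 'I_n -> lattice d -> \bar R) u :
  (forall i x, 0 <= c i x) -> 0 <= convn c u.
Proof.
by move=> c0; apply: esum_ge0 => x _; rewrite mule_ge0 ?lee_fin ?prode_ge0'.
Qed.

Lemma convnS n (c : 'I_n.+1 -> lattice d -> \bar R) : (forall i x, 0 <= c i x) ->
  convn c = convolution (c ord0) (convn (fun i => c (lift ord0 i))).
Proof.
move=> c0; apply/funext => u; rewrite /convn esum_ffunS; last first.
  by move=> f; rewrite mule_ge0 ?lee_fin ?prode_ge0'.
apply: eq_esum => a _; rewrite -esumZl//; last first.
  by move=> f; rewrite mule_ge0 ?lee_fin ?prode_ge0'.
apply: eq_esum => f _; rewrite !big_ord_recl fcons0 muleCA; congr (_ * (_ * _)).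
  under eq_bigr do rewrite fconsS.
  by rewrite addrC eq_sym -subr_eq eq_sym.
by apply: eq_bigr => i _; rewrite fconsS.
Qed.

(** The factors [edelta] are neutral, so only the number of indices with [eps i] true matters. *)
Lemma convn_delta n (g : lattice d -> \bar R) (eps : 'I_n -> bool) :
  (forall x, 0 <= g x) ->
  convn (fun i => if eps i then g else @edelta R d) = conv_pow0 g (\sum_i eps i)%N.
Proof.
move=> g0; elim: n eps => [|n IH] eps.
  rewrite big_ord0; apply/funext => u; rewrite /convn.
  rewrite (@esum_ffun0 _ _ _ (ffun0 (card_ord 0))) ?big_ord0 ?mule1 ?lee_fin//.
  by rewrite /= /edelta /delta0 eq_sym.
rewrite convnS; last by move=> i x; case: ifP => // _; exact: edelta_ge0.
rewrite (IH (fun i => eps (lift ord0 i))) big_ord_recl.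
have p0 k x : 0 <= conv_pow0 g k x by exact: conv_pow0_ge0.
case: (eps ord0); first by rewrite add1n conv_pow0S// convolutionC.
by rewrite add0n convolution_delta.
Qed.

Lemma esum_prod_sum n (c : 'I_n -> lattice d -> \bar R) (F : lattice d -> \bar R) :
  (forall i x, 0 <= c i x) -> (forall x, 0 <= F x) ->
  \esum_(w in [set: {ffun 'I_n -> lattice d}])
    (\prod_(i < n) c i (w i) * F (\sum_i w i)%R) =
  \esum_(u in [set: lattice d]) (convn c u * F u).
Proof.
move=> c0 F0.
transitivity (\esum_(w in [set: {ffun 'I_n -> lattice d}]) \esum_(u in [set: lattice d])
   ((F u * (((\sum_i w i)%R == u)%:R%:E * \prod_(i < n) c i (w i))))).
  apply: eq_esum => w _; rewrite (@esum_only _ _ (\sum_i w i)%R).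
  - by rewrite eqxx mul1e muleC.
  - by rewrite mule_ge0// mule_ge0 ?lee_fin ?prode_ge0'.
  - by move=> u; rewrite eq_sym => /negbTE ->; rewrite mul0e mule0.
rewrite esum_exchange; last first.
  by move=> w u; rewrite mule_ge0// mule_ge0 ?lee_fin ?prode_ge0'.
apply: eq_esum => u _; rewrite esumZl//; first by rewrite muleC.
by move=> w; rewrite mule_ge0 ?lee_fin ?prode_ge0'.
Qed.

Lemma convn_shift n (c : 'I_n -> lattice d -> \bar R) 
    (w : {ffun 'I_n -> lattice d}) (z a : lattice d) :
  \esum_(x in [set: {ffun 'I_n -> lattice d}])
    ((z + \sum_i x i == a)%R%:R%:E * \prod_(i < n) c i (x i - w i)%R) =
  convn c (a - z - \sum_i w i)%R.
Proof.
rewrite (reindex_esumT (e := fun x : {ffun 'I_n -> lattice d} => [ffun i => x i + w i]%R)).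
  apply: eq_esum => x _; congr (_%:R%:E * _); last first.
    by apply: eq_bigr => i _; rewrite ffunE addrK.
  under eq_bigr do rewrite ffunE.
  by rewrite big_split/= [in RHS]eq_sym !subr_eq [in RHS]eq_sym (addrC z).
exists (fun x : {ffun 'I_n -> lattice d} => [ffun i => x i - w i]%R) => x;
  by apply/ffunP => i; rewrite !ffunE ?addrK ?subrK.
Qed.

(* [w] is the sum of the positions of the walks at the earlier of their two
   times; [eps i] tells that this position is [y i] rather than [x i]. *)
Lemma esum_split_walks n (g : lattice d -> \bar R) (eps : 'I_n -> bool) (z a b : lattice d) :
  (forall x, 0 <= g x) ->
  \esum_(x in [set: {ffun 'I_n -> lattice d}])
  \esum_(y in [set: {ffun 'I_n -> lattice d}])
    ((z + \sum_i x i == a)%R%:R%:E * (z + \sum_i y i == b)%R%:R%:E *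
     \prod_(i < n) (if eps i then g (y i) * g (x i - y i)%R
                    else g (x i) * g (y i - x i)%R)) =
  \esum_(w in [set: lattice d])
    (conv_pow0 g n w * (conv_pow0 g (\sum_i eps i)%N (a - z - w)%R *
       conv_pow0 g (\sum_i ~~ eps i)%N (b - z - w)%R)).
Proof.
move=> g0.
pose c (e : bool) : lattice d -> \bar R := if e then g else @edelta R d.
have c0 e x : 0 <= c e x by rewrite /c; case: e => //; exact: edelta_ge0.
(* Both orders of visit get the same form: a Green's function up to a splitting place [w], then one
   factor for each target, one of them a delta that pins [w] to the place visited first. *)
have K x y (e : bool) : (if e then g y * g (x - y)%R else g x * g (y - x)%R) =
    \esum_(w in [set: lattice d]) (g w * (c e (x - w)%R * c (~~ e) (y - w)%R)).
  case: e; rewrite /c /=.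
    rewrite (@esum_only _ _ y) ?subrr.
    - by rewrite /edelta /delta0 eqxx mule1.
    - by rewrite !mule_ge0// edelta_ge0.
    - by move=> w; rewrite eq_sym /edelta /delta0 subr_eq0 => /negbTE ->; rewrite !mule0.
  rewrite (@esum_only _ _ x) ?subrr.
  - by rewrite /edelta /delta0 eqxx mul1e.
  - by rewrite !mule_ge0// edelta_ge0.
  - by move=> w; rewrite eq_sym /edelta /delta0 subr_eq0 => /negbTE ->; rewrite mul0e mule0.
pose L := [set: {ffun 'I_n -> lattice d}].
transitivity (\esum_(x in L) \esum_(y in L) \esum_(w in L)
   (\prod_(i < n) g (w i) *
    (((z + \sum_i x i == a)%R%:R%:E * \prod_(i < n) c (eps i) (x i - w i)%R) *
    ((z + \sum_i y i == b)%R%:R%:E * \prod_(i < n) c (~~ eps i) (y i - w i)%R)))).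
  apply: eq_esum => x _; apply: eq_esum => y _.
  rewrite (eq_bigr _ (fun i _ => K (x i) (y i) (eps i))) prod_esum; last first.
    by move=> i w; rewrite !mule_ge0.
  rewrite -esumZl; last 2 first.
  - by rewrite mule_ge0 ?lee_fin.
  - by move=> w; apply: prode_ge0' => i; rewrite !mule_ge0.
  apply: eq_esum => w _; rewrite !big_split/=.
  by rewrite [LHS]muleCA; congr (_ * _); rewrite muleACA.
have P0 (F : 'I_n -> \bar R) : (forall i, 0 <= F i) -> 0 <= \prod_(i < n) F i := @prode_ge0' n F.
have T0 (x y w : {ffun 'I_n -> lattice d}) : 0 <= (\prod_(i < n) g (w i) *
    (((z + \sum_i x i == a)%R%:R%:E * \prod_(i < n) c (eps i) (x i - w i)%R) *
    ((z + \sum_i y i == b)%R%:R%:E * \prod_(i < n) c (~~ eps i) (y i - w i)%R))).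
  by apply: mule_ge0; [by apply: P0 => i|apply: mule_ge0; apply: mule_ge0; rewrite ?lee_fin ?P0].
transitivity (\esum_(x in L) \esum_(w in L) \esum_(y in L)
   (\prod_(i < n) g (w i) *
    (((z + \sum_i x i == a)%R%:R%:E * \prod_(i < n) c (eps i) (x i - w i)%R) *
    ((z + \sum_i y i == b)%R%:R%:E * \prod_(i < n) c (~~ eps i) (y i - w i)%R)))).
  by apply: eq_esum => x _; exact: esum_exchange.
rewrite esum_exchange; last by move=> x w; apply: esum_ge0.
(* For fixed [w] the sums over [x] and [y] decouple, and each depends on [w] only through its
   total. *)
transitivity (\esum_(w in L) (\prod_(i < n) g (w i) *
   (convn (fun i => c (eps i)) (a - z - \sum_i w i)%R *
    convn (fun i => c (~~ eps i)) (b - z - \sum_i w i)%R))).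
  apply: eq_esum => w _.
  rewrite -!convn_shift mule_esum; last 2 first.
  - by move=> x; apply: mule_ge0; rewrite ?lee_fin ?P0.
  - by move=> x; apply: mule_ge0; rewrite ?lee_fin ?P0.
  rewrite -esumZl; last 2 first.
  - by apply: P0 => i.
  - move=> x; apply: esum_ge0 => y _.
    by apply: mule_ge0; apply: mule_ge0; rewrite ?lee_fin ?P0.
  apply: eq_esum => x _; rewrite [LHS]esumZl//; first by apply: P0 => i.
  by move=> y; apply: mule_ge0; apply: mule_ge0; rewrite ?lee_fin ?P0.
rewrite (@esum_prod_sum _ (fun=> g) (fun u => convn (fun i => c (eps i)) (a - z - u)%R *
    convn (fun i => c (~~ eps i)) (b - z - u)%R))//; last first.
  by move=> u; apply: mule_ge0; apply: convn_ge0.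
have cg : convn (fun _ : 'I_n => g) = conv_pow0 g n.
  have := convn_delta (fun _ : 'I_n => true) g0.
  by rewrite /= big_const_ord iter_addn_0 mul1n.
apply: eq_esum => w _; rewrite cg; congr (_ * (_ * _)).
  by rewrite /c convn_delta.
by rewrite /c convn_delta.
Qed.

End iterated_convolution.

(** * Laws of the walks *)

Section lattice_measurability.
Local Open Scope ereal_scope.
Context {disp : measure_display} {T : measurableType disp} {R : realType}
  (P : probability T R) {d : nat}.

Lemma measurable_RV_eq (f : {RV P >-> lattice d}) (c : lattice d) :
  measurable [set w | f w = c].
Proof.
have := @measurable_funPT _ _ _ _ f measurableT [set c] I.
by rewrite setTI.
Qed.

Lemma measurable_lattice_pred (f g : {RV P >-> lattice d}) (p : lattice d -> lattice d -> Prop) :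
  measurable [set w | p (f w) (g w)].
Proof.
rewrite (_ : [set w | _] = \bigcup_(c : lattice d * lattice d)
  ([set w | f w = c.1] `&` [set w | g w = c.2] `&` [set w | p c.1 c.2])).
  apply: countable_bigcupT_measurable => // c.
  apply: measurableI; first by apply: measurableI; exact: measurable_RV_eq.
  have [pc|npc] := pselect (p c.1 c.2).
    by rewrite (_ : [set _ | _] = setT)//; apply/seteqP; split.
  by rewrite (_ : [set _ | _] = set0)//; apply/seteqP; split.
apply/seteqP; split => [w pw|w [c _ [[/= -> ->]]]//].
by exists (f w, g w).
Qed.

Lemma probability_partition (f : T -> lattice d) (E : set T) : measurable E ->
  (forall c, measurable [set w | f w = c]) ->
  P E = \esum_(c in [set: lattice d]) P ([set w | f w = c] `&` E).
Proof.
move=> mE mf; rewrite -[in LHS](setIT E) -integral_indic//.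
transitivity (\int[P]_w \esum_(c in [set: lattice d]) (\1_([set w | f w = c] `&` E) w)%:E).
  apply: eq_integral => w _; rewrite (@esum_only _ _ (f w)).
  - by rewrite !indicE in_setI [X in (X && _)%R]mem_set.
  - by rewrite lee_fin.
  - move=> c fc; rewrite indicE in_setI [X in (X && _)%R]memNset//= => h.
    by rewrite h eqxx in fc.
rewrite integral_esum; last 2 first.
- by move=> c; apply/measurable_EFinP/measurable_indic/measurableI.
- by move=> c w; rewrite lee_fin.
apply: eq_esum => c _; rewrite integral_indic// ?setIT//.
exact: measurableI.
Qed.

End lattice_measurability.

Section single_walk.
Local Open Scope ereal_scope.
Context {disp : measure_display} {T : measurableType disp} {R : realType}
  {P : probability T R} {d : nat}.
Variable X : nat -> {RV P >-> lattice d}.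
Hypothesis srwX : simple_random_walk X.

Let mu (e : lattice d) : R := if is_unit_step e then (2 * d)%:R^-1%R else 0%R.

Let mu_ge0 e : (0 <= mu e)%R.
Proof. by rewrite /mu; case: ifP => // _; rewrite invr_ge0. Qed.

Let step_inj : injective (@step d).
Proof.
have delta_neq (i j : 'I_d) : delta_mx ord0 i != (- delta_mx ord0 j)%R :> lattice d.
  by apply/eqP => /rowP/(_ i); rewrite !mxE !eqxx/=; case: (i == j).
have dinj (i j : 'I_d) : delta_mx ord0 i = delta_mx ord0 j :> lattice d -> i = j.
  by move=> /rowP/(_ i); rewrite !mxE !eqxx/=; case: eqP.
move=> [i b] [j c]; rewrite /step /=; case: b; case: c.
- by move=> /dinj ->.
- by move=> /eqP; rewrite (negbTE (delta_neq i j)).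
- by move=> /esym/eqP; rewrite (negbTE (delta_neq j i)).
- by move=> /oppr_inj/dinj ->.
Qed.

(** Connects the law of the increments, given by [is_unit_step], with the sum over signed axes in
    [avg]. Injectivity of [step] means that exactly one signed axis contributes. *)
Let muE e : mu e = (\sum_p (2 * d)%:R^-1 * (e == step p)%:R)%R.
Proof.
rewrite /mu; case: ifPn => [/existsP[i]|] ue.
  have [b eb] : exists b, e = step (i, b).
    by case/orP: ue => /eqP ->; [exists true|exists false].
  rewrite (bigD1 (i, b))//= big1 ?addr0; first by rewrite eb eqxx mulr1.
  move=> p pib; rewrite eb (_ : (_ == _) = false) ?mulr0//.
  by apply/negbTE; apply: contra pib => /eqP/step_inj ->.
rewrite big1// => -[i b] _; rewrite (_ : (_ == _) = false) ?mulr0//.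
apply/negbTE; apply: contra ue => /eqP ->; apply/existsP; exists i.
by rewrite /step; case: b => /=; rewrite eqxx ?orbT.
Qed.

Let esum_mu (f : lattice d -> R) x : (forall y, (0 <= f y)%R) ->
  \esum_(c in [set: lattice d]) (mu c * f (x - c))%:E = (avg f x)%:E.
Proof.
move=> f0; transitivity (\esum_(c in [set: lattice d])
    \sum_p ((2 * d)%:R^-1 * ((c == step p)%:R * f (x - c)))%:E).
  apply: eq_esum => c _; rewrite sumEFin muE mulr_suml; congr EFin.
  by apply: eq_bigr => p _; rewrite mulrA.
rewrite esum_sum; last by move=> c p _ _; rewrite lee_fin mulr_ge0 ?invr_ge0 ?mulr_ge0.
rewrite /avg mulr_sumr -sumEFin; apply: eq_bigr => p _.
rewrite (@esum_only _ _ (step p)) ?eqxx ?mul1r//.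
- by rewrite lee_fin mulr_ge0 ?invr_ge0 ?mulr_ge0.
- by move=> c /negbTE ->; rewrite mul0r mulr0.
Qed.

Let inc n : T -> lattice d := increment X n.

Let minc n c : measurable [set w | inc n w = c].
Proof. exact: (@measurable_lattice_pred _ _ _ P d (X n.+1) (X n) (fun u v => u - v = c)%R). Qed.

Let XE n w : X n w = (\sum_(j < n) inc j w)%R.
Proof.
elim: n => [|n IH]; first by rewrite big_ord0; case: srwX => ->.
by rewrite big_ord_recr /= -IH /inc /increment addrC subrK.
Qed.

(** Prescribing the first [n] increments replaces conditioning on the past: the Markov property
    becomes an induction on these events. *)
Let cyl n (e : nat -> lattice d) : set T :=
  \bigcap_(j in [set j | (j < n)%N]) [set w | inc j w = e j].

Let mcyl n e : measurable (cyl n e).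
Proof. by apply: bigcap_measurableType => j _; exact: minc. Qed.

Let P_cyl n e : P (cyl n e) = (\prod_(j < n) mu (e j))%:E.
Proof.
have [_ indep stepP] := srwX.
have := indep [fset j in iota 0 n]%fset (fun j => [set w | inc j w = e j]).
rewrite (_ : \bigcap_(_ in _) _ = cyl n e); last first.
  apply/seteqP; split => w h j /= jn; apply: h => /=.
    by rewrite !inE mem_iota.
  by move: jn; rewrite !inE mem_iota.
move=> ->; last first.
  by move=> j _; exists [set e j] => //; rewrite setTI.
rewrite (perm_big (iota 0 n)); last first.
  by apply: uniq_perm; rewrite ?iota_uniq ?fset_uniq// => j; rewrite !inE.
rewrite -[in iota 0 n](subn0 n) -/(index_iota 0 n) big_mkord -prodEFin.
apply: eq_bigr => j _; have := stepP j (e j).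
by rewrite /mu; case: ifP.
Qed.

Let upd (e : nat -> lattice d) n c j := if j == n then c else e j.

Let cylS n e c : cyl n.+1 (upd e n c) = [set w | inc n w = c] `&` cyl n e.
Proof.
apply/seteqP; split => [w h|w [/= h1 h2] j /=].
  split => [|j jn]; first by have := h n (ltnSn n); rewrite /= /upd eqxx.
  by have := h j (leqW jn); rewrite /= /upd ltn_eqF.
rewrite ltnS leq_eqVlt /upd => /orP[/eqP ->|jn]; first by rewrite eqxx.
by rewrite ltn_eqF//; exact: h2.
Qed.

Let sum_upd n e c : (\sum_(j < n.+1) upd e n c j = \sum_(j < n) e j + c)%R.
Proof.
rewrite big_ord_recr/= /upd eqxx; congr (_ + _)%R.
by apply: eq_bigr => j _; rewrite ltn_eqF.
Qed.

Let prod_upd n e c : (\prod_(j < n.+1) mu (upd e n c j) = \prod_(j < n) mu (e j) * mu c)%R.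
Proof.
rewrite big_ord_recr/= /upd eqxx; congr (_ * _)%R.
by apply: eq_bigr => j _; rewrite ltn_eqF.
Qed.

Let prod_mu_ge0 n (e : nat -> lattice d) : (0 <= \prod_(j < n) mu (e j))%R.
Proof. by apply: prodr_ge0 => j _. Qed.

(* One step of the induction: conditioning on the next increment turns the
   heat kernel at time [k] into the one at time [k.+1]. *)
Let P_cylS (E : set T) (k : nat) (c0 : R) (x : lattice d) : measurable E -> (0 <= c0)%R ->
  forall n e,
  (forall c, P (cyl n.+1 (upd e n c) `&` E) = (\prod_(j < n.+1) mu (upd e n c j) *
     (heat R k (x - \sum_(j < n.+1) upd e n c j) * c0))%R%:E) ->
  P (cyl n e `&` E) = (\prod_(j < n) mu (e j) *
     (heat R k.+1 (x - \sum_(j < n) e j) * c0))%R%:E.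
Proof.
move=> mE c00 n e h.
rewrite (probability_partition P (measurableI _ _ (mcyl n e) mE) (minc n)).
transitivity (\esum_(c in [set: lattice d])
   ((\prod_(j < n) mu (e j) * c0)%:E * (mu c * heat R k ((x - \sum_(j < n) e j) - c))%:E)).
  apply: eq_esum => c _; rewrite setIA -cylS h prod_upd sum_upd -EFinM; congr EFin.
  by rewrite opprD addrA; ring.
rewrite esumZl ?lee_fin ?mulr_ge0//; last by move=> c; rewrite lee_fin mulr_ge0 ?heat_ge0.
rewrite esum_mu; last exact: heat_ge0.
by rewrite -EFinM; congr EFin; rewrite /heat /=; ring.
Qed.

(** Induction on the remaining time [k] with the prefix generalized: each step moves one unit of
    time into the prefix, until the position is determined. *)
Let P_cyl_at n e (y : lattice d) k : P (cyl n e `&` [set w | X (n + k)%N w = y]) =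
  (\prod_(j < n) mu (e j) * (heat R k (y - \sum_(j < n) e j)))%R%:E.
Proof.
elim: k n e => [|k IH] n e.
  rewrite addn0 /heat /= /delta0 subr_eq0.
  have cX w : cyl n e w -> X n w = (\sum_(j < n) e j)%R.
    by move=> h; rewrite XE; apply: eq_bigr => j _; exact: (h j (ltn_ord j)).
  have [ye|ye] := eqVneq y (\sum_(j < n) e j)%R.
    rewrite mulr1 -P_cyl; congr (P _); apply/seteqP; split => [w []//|w h].
    by split => //=; rewrite cX.
  rewrite mulr0 (_ : _ `&` _ = set0) ?measure0//.
  by apply/seteqP; split => // w [/cX + /= wy]; rewrite wy => /eqP; rewrite (negbTE ye).
have := @P_cylS [set w | X (n + k.+1)%N w = y] k 1%R y (measurable_RV_eq _ _) ler01 n e.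
rewrite !mulr1 => H; apply: H => c; rewrite mulr1.
by rewrite -addSnnS; exact: IH.
Qed.

(** The same induction, on the time [j] left before the first visit; at [j = 0] the prefix ends at
    [x] and [P_cyl_at] handles the second visit. *)
Let P_cyl_at2 n e (x y : lattice d) j k :
  P (cyl n e `&` ([set w | X (n + j)%N w = x] `&` [set w | X (n + j + k)%N w = y])) =
  (\prod_(j < n) mu (e j) * (heat R j (x - \sum_(j < n) e j) * heat R k (y - x)))%R%:E.
Proof.
elim: j n e => [|j IH] n e.
  rewrite addn0 {1}/heat /= /delta0 subr_eq0.
  have cX w : cyl n e w -> X n w = (\sum_(j < n) e j)%R.
    by move=> h; rewrite XE; apply: eq_bigr => j _; exact: (h j (ltn_ord j)).
  have [xe|xe] := eqVneq x (\sum_(j < n) e j)%R.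
    rewrite mul1r xe -P_cyl_at; congr (P _); apply/seteqP.
    split => [w [? []]//|w [h1 h2]]; split => //; split => //=.
    by rewrite cX.
  rewrite mul0r mulr0 (_ : _ `&` _ = set0) ?measure0//.
  by apply/seteqP; split => // w [/cX + [/= wx _]]; rewrite wx => /eqP; rewrite (negbTE xe).
have mE : measurable ([set w | X (n + j.+1)%N w = x] `&` [set w | X (n + j.+1 + k)%N w = y]).
  by apply: measurableI; exact: measurable_RV_eq.
have h0 := heat_ge0 R k (y - x)%R.
apply: (@P_cylS _ j _ x mE h0 n e) => c.
by rewrite -addSnnS; exact: IH.
Qed.

Lemma walk_joint_law (x y : lattice d) j k :
  P ([set w | X j w = x] `&` [set w | X (j + k)%N w = y]) =
  (heat R j x * heat R k (y - x))%:E.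
Proof.
have := P_cyl_at2 0 (fun=> 0%R) x y j k; rewrite !big_ord0 subr0 mul1r !add0n => <-.
by congr (P _); rewrite (_ : cyl _ _ = setT) ?setTI//; apply/seteqP; split.
Qed.

Lemma walk_law (x : lattice d) n : P [set w | X n w = x] = (heat R n x)%:E.
Proof.
have := P_cyl_at 0 (fun=> 0%R) x n; rewrite !big_ord0 subr0 mul1r add0n => <-.
by congr (P _); rewrite (_ : cyl _ _ = setT) ?setTI//; apply/seteqP; split.
Qed.

Lemma green_walk : green P X = pot (@delta0 R d).
Proof.
apply/funext => x; rewrite /green /pot.
have E n w : ((X n w == x)%:R : R)%:E = (\1_[set w | X n w = x] w)%:E.
  rewrite indicE; congr (_%:R%:E); congr nat_of_bool; apply/eqP/idP => [h|].
    by rewrite inE.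
  by rewrite inE.
rewrite integral_nneseries//=; last first.
  move=> n; under eq_fun do rewrite E.
  exact/measurable_EFinP/measurable_indic/measurable_RV_eq.
apply: eq_eseriesr => n _; under eq_integral do rewrite E.
rewrite integral_indic//; last exact: measurable_RV_eq.
by rewrite setIT; exact: walk_law.
Qed.

Local Notation gr := (pot (@delta0 R d)).

Lemma esum_shift (F : nat -> \bar R) t : (forall n, 0 <= F n) ->
  \esum_(s in [set: nat]) (if (t <= s)%N then F (s - t)%N else 0) =
  \esum_(k in [set: nat]) F k.
Proof.
move=> F0; transitivity (\esum_(s in [set s | (t <= s)%N]) F (s - t)%N).
  rewrite [RHS]esum_mkcond; apply: eq_esum => s _.
  by rewrite (_ : (s \in _) = (t <= s)%N)//; apply/idP/idP; rewrite inE.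
rewrite (reindex_esum setT _ (addn t)).
  by apply: eq_esum => s _; rewrite addKn.
split => [s _ /=|s s' _ _ /addnI //|s /= ts]; first exact: leq_addr.
by exists (s - t)%N => //; rewrite subnKC.
Qed.

(** Sum over [t <= s] and over [s <= t] separately; by [walk_joint_law] each factors into two
    Green's functions. The diagonal is counted twice, hence an inequality. *)
Lemma esum_pair_walk_le (x y : lattice d) :
  \esum_(t in [set: nat]) \esum_(s in [set: nat])
     P ([set w | X t w = x] `&` [set w | X s w = y])
  <= \esum_(b in [set: bool]) (if b then gr y * gr (x - y)%R else gr x * gr (y - x)%R).
Proof.
have half u v : \esum_(t in [set: nat]) \esum_(s in [set: nat])
    (if (t <= s)%N then (heat R t u * heat R (s - t) v)%:E else 0) = gr u * gr v.
  transitivity (\esum_(t in [set: nat]) ((heat R t u)%:E * gr v)).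
    apply: eq_esum => t _; rewrite /pot nneseries_esumT; last first.
      by move=> n; rewrite lee_fin heat_ge0.
    rewrite -esumZl ?lee_fin ?heat_ge0//; last by move=> n; rewrite lee_fin heat_ge0.
    rewrite -[RHS](@esum_shift _ t); last by move=> n; rewrite -EFinM lee_fin mulr_ge0 ?heat_ge0.
    by apply: eq_esum => s _; case: ifP.
  under eq_esum do rewrite muleC.
  rewrite esumZl ?gr_ge0//; last by move=> t; rewrite lee_fin heat_ge0.
  rewrite muleC; congr (_ * _); rewrite /pot nneseries_esumT// => n.
  by rewrite lee_fin heat_ge0.
have h0 t s u v : 0 <= (if (t <= s)%N then (heat R t u * heat R (s - t) v)%:E else 0 : \bar R).
  by case: ifP => // _; rewrite lee_fin mulr_ge0 ?heat_ge0.
rewrite esum_fin; last by case; rewrite mule_ge0 ?gr_ge0.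
rewrite big_bool/= -!half [X in _ <= X + _]esum_exchange// -esumD; last 2 first.
- by move=> t _; apply: esum_ge0.
- by move=> t _; apply: esum_ge0.
apply: le_esum => t _; rewrite -esumD//; apply: le_esum => s _.
case: (leqP t s) => ts.
  rewrite -{1}(subnKC ts) walk_joint_law leeDr//.
rewrite (ltnW ts) setIC -{1}(subnKC (ltnW ts)) walk_joint_law adde0//.
Qed.

End single_walk.

(** * The second moment *)

Section second_moment.
Local Open Scope ereal_scope.
Context {disp : measure_display} {T : measurableType disp} {R : realType}
  {P : probability T R} {d N : nat}.
Variable X : 'I_N -> nat -> {RV P >-> lattice d}.
Hypothesis hX : independent_walks X.

Local Notation gr := (pot (@delta0 R d)).
Local Notation G := (conv_pow0 gr).
Local Notation times := {ffun 'I_N -> nat}.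
Local Notation places := {ffun 'I_N -> lattice d}.

Let at_ (t : times) (x : places) : set T :=
  \bigcap_(i in [set: 'I_N]) [set w | X i (t i) w = x i].

Let mat_ t x : measurable (at_ t x).
Proof.
by apply: fin_bigcap_measurable => // i _; exact: measurable_RV_eq.
Qed.

(** For each [i], the constraints at both times lie in the same [sigma_process], so independence of
    the walks applies to their intersection. *)
Let at2E t s x y : P (at_ t x `&` at_ s y) =
  \prod_(i < N) P ([set w | X i (t i) w = x i] `&` [set w | X i (s i) w = y i]).
Proof.
have [_ indep] := hX.
have := indep [fset i in enum 'I_N]%fset
  (fun i => [set w | X i (t i) w = x i] `&` [set w | X i (s i) w = y i]).
rewrite (_ : \bigcap_(_ in _) _ = at_ t x `&` at_ s y); last first.
  apply/seteqP; split => [w h|w [h1 h2] i _].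
    by split => i _; have [] := h i; rewrite //= !inE mem_enum.
  by split; [exact: h1|exact: h2].
move=> ->; last first.
  move=> i _.
  have in_process n c : sigma_process (X i) [set w | X i n w = c].
    apply: sub_sigma_algebra; exists n => //; exists [set c] => //.
    by rewrite setTI.
  by apply: (@measurableI _ (g_sigma_algebraType
    (\bigcup_n g_sigma_algebra_preimage (X i n)))); exact: in_process.
rewrite (perm_big (enum 'I_N)); last first.
  by apply: uniq_perm; rewrite ?enum_uniq ?fset_uniq// => j; rewrite !inE.
by rewrite big_enum.
Qed.

(** Introducing the places visited makes the condition on the sum deterministic and leaves events
    that factor over the walks. *)
Let local_timeE z a w : local_time R X z a w =
  \esum_(x in [set: places]) \esum_(t in [set: times])
     (((z + \sum_i x i)%R == a)%:R%:E * (\1_(at_ t x) w)%:E).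
Proof.
rewrite esum_exchange; last by move=> *; rewrite mule_ge0.
apply: eq_esum => t _; rewrite (@esum_only _ _ [ffun i => X i (t i) w]).
- rewrite indicE mem_set ?mule1; last by move=> i _ /=; rewrite ffunE.
  by under [in RHS]eq_bigr do rewrite ffunE.
- by rewrite mule_ge0.
- move=> x xX; rewrite indicE memNset ?mule0// => h; case/eqP: xX.
  by apply/ffunP => i; rewrite ffunE; have := h i I.
Qed.

Let lee_prode n (u v : 'I_n -> \bar R) : (forall i, 0 <= u i) -> (forall i, u i <= v i) ->
  \prod_(i < n) u i <= \prod_(i < n) v i.
Proof.
move=> u0 uv.
suff /andP[] : (0 <= \prod_(i < n) u i) && (\prod_(i < n) u i <= \prod_(i < n) v i) by [].
apply: (big_ind2 (fun p q : \bar R => (0 <= p) && (p <= q))).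
- by rewrite lexx andbT.
- move=> p q p' q' /andP[p0 pq] /andP[p0' pq'].
  by rewrite mule_ge0//= lee_pmul.
- by move=> i _; rewrite u0 uv.
Qed.

Let K (e : bool) (x y : lattice d) : \bar R :=
  if e then gr y * gr (x - y)%R else gr x * gr (y - x)%R.

Let K_ge0 e x y : 0 <= K e x y.
Proof. by rewrite /K; case: e; rewrite mule_ge0 ?gr_ge0. Qed.

(** The double sum over times is a product over the walks of sums over pairs of times. Bounding each
    factor by its two orders and expanding gives the [2 ^ N] choices [eps]. *)
Let esum_at2_le (x y : places) :
  \esum_(t in [set: times]) \esum_(s in [set: times]) P (at_ t x `&` at_ s y) <=
  \esum_(eps in [set: {ffun 'I_N -> bool}]) \prod_(i < N) K (eps i) (x i) (y i).
Proof.
pose q i t s := P ([set w | X i t w = x i] `&` [set w | X i s w = y i]).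
have -> : \esum_(t in [set: times]) \esum_(s in [set: times]) P (at_ t x `&` at_ s y) =
    \prod_(i < N) (\esum_(t in [set: nat]) \esum_(s in [set: nat]) q i t s).
  rewrite prod_esum; last by move=> i t; apply: esum_ge0 => s _; exact: measure_ge0.
  apply: eq_esum => t _; rewrite prod_esum; last by move=> i s; exact: measure_ge0.
  by apply: eq_esum => s _; exact: at2E.
rewrite -(prod_esum (c := fun i e => K e (x i) (y i))); last by move=> i e; exact: K_ge0.
apply: lee_prode => i; first by do 2!apply: esum_ge0 => ? _; exact: measure_ge0.
by apply: esum_pair_walk_le; case: hX.
Qed.

Lemma second_moment_le (z a b : lattice d) :
  \int[P]_w (local_time R X z a w * local_time R X z b w) <=
  \esum_(eps in [set: {ffun 'I_N -> bool}]) \esum_(w in [set: lattice d])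
    (G N w * (G (\sum_i eps i)%N (a - z - w)%R * G (\sum_i ~~ eps i)%N (b - z - w)%R)).
Proof.
pose c u (x : places) : \bar R := ((z + \sum_i x i == u)%R%:R)%:E.
have c0 u x : 0 <= c u x by rewrite lee_fin.
have i0 (A : set T) w : 0 <= (\1_A w : R)%:E by rewrite lee_fin.
have f0 x y t s w : 0 <= c a x * c b y * (\1_(at_ t x `&` at_ s y) w : R)%:E.
  by rewrite !mule_ge0.
have -> : \int[P]_w (local_time R X z a w * local_time R X z b w) =
  \int[P]_w (\esum_(x in [set: places]) \esum_(y in [set: places])
   \esum_(t in [set: times]) \esum_(s in [set: times])
     (c a x * c b y * (\1_(at_ t x `&` at_ s y) w : R)%:E)).
  apply: eq_integral => w _; rewrite !local_timeE mule_esum; last 2 first.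
  - by move=> x; apply: esum_ge0 => t _; rewrite mule_ge0.
  - by move=> x; apply: esum_ge0 => t _; rewrite mule_ge0.
  apply: eq_esum => x _; apply: eq_esum => y _; rewrite mule_esum; last 2 first.
  - by move=> t; rewrite mule_ge0.
  - by move=> t; rewrite mule_ge0.
  apply: eq_esum => t _; apply: eq_esum => s _.
  by rewrite muleACA; congr (_ * _); rewrite -EFinM indicI.
have mf x y t s : measurable_fun setT
    (fun w => c a x * c b y * (\1_(at_ t x `&` at_ s y) w : R)%:E).
  rewrite /c -EFinM; apply: measurable_funeM.
  apply/measurable_EFinP; apply: measurable_indic; exact: measurableI.
have mf1 x y t : measurable_fun setT (fun w => \esum_(s in [set: times])
    (c a x * c b y * (\1_(at_ t x `&` at_ s y) w : R)%:E)).
  exact: measurable_esum.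
have mf2 x y : measurable_fun setT (fun w => \esum_(t in [set: times]) \esum_(s in [set: times])
    (c a x * c b y * (\1_(at_ t x `&` at_ s y) w : R)%:E)).
  by apply: measurable_esum => // t w; apply: esum_ge0.
rewrite integral_esum; last 2 first.
- by move=> x; apply: measurable_esum => y *; do ?[exact: mf2|apply: esum_ge0 => ? _].
- by move=> x w; do ?[apply: esum_ge0 => ? _].
(* The right-hand side is unfolded back to a sum over places [x] and [y], so that the two sides can
   be compared term by term. *)
have -> : \esum_(eps in [set: {ffun 'I_N -> bool}]) \esum_(w in [set: lattice d])
    (G N w * (G (\sum_i eps i)%N (a - z - w)%R * G (\sum_i ~~ eps i)%N (b - z - w)%R)) =
  \esum_(x in [set: places]) \esum_(y in [set: places]) (c a x * c b y *
   \esum_(eps in [set: {ffun 'I_N -> bool}]) \prod_(i < N) K (eps i) (x i) (y i)).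
  have p0 (eps : {ffun 'I_N -> bool}) (x y : places) : 0 <= \prod_(i < N) K (eps i) (x i) (y i).
    by apply: prode_ge0 => i _; exact: K_ge0.
  transitivity (\esum_(eps in [set: {ffun 'I_N -> bool}])
     \esum_(x in [set: places]) \esum_(y in [set: places]) (c a x * c b y *
     \prod_(i < N) K (eps i) (x i) (y i))).
    by apply: eq_esum => eps _; rewrite -esum_split_walks//; exact: gr_ge0.
  rewrite esum_exchange; last by move=> eps x; apply: esum_ge0 => y _; rewrite !mule_ge0.
  apply: eq_esum => x _.
  rewrite esum_exchange; last by move=> eps y; rewrite !mule_ge0.
  by apply: eq_esum => y _; rewrite esumZl// mule_ge0.
apply: le_esum => x _.
rewrite integral_esum; last 2 first.
- by move=> y; exact: mf2.
- by move=> y w; do ?[apply: esum_ge0 => ? _].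
apply: le_esum => y _.
apply: le_trans (_ : c a x * c b y *
   (\esum_(t in [set: times]) \esum_(s in [set: times]) P (at_ t x `&` at_ s y)) <= _); last first.
  by apply: lee_wpmul2l; [rewrite mule_ge0|exact: esum_at2_le].
rewrite integral_esum; last 2 first.
- by move=> t; exact: mf1.
- by move=> t w; apply: esum_ge0.
rewrite -esumZl; last 2 first.
- by rewrite mule_ge0.
- by move=> t; apply: esum_ge0 => s _; exact: measure_ge0.
apply: le_esum => t _; rewrite integral_esum//.
rewrite -esumZl; last 2 first.
- by rewrite mule_ge0.
- by move=> s; exact: measure_ge0.
apply: le_esum => s _.
rewrite ge0_integralZl//; last 2 first.
- apply/measurable_EFinP; apply: measurable_indic; exact: measurableI.
- by rewrite mule_ge0.
by rewrite integral_indic ?setIT//; exact: measurableI.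
Qed.

End second_moment.

Section second_moment_bound.
Local Open Scope ereal_scope.

Lemma second_moment_bound (R : realType) (d N : nat) : (0 < N)%N -> (2 * N < d)%N ->
  exists C : R, (0 < C)%R /\
  forall (disp : measure_display) (T : measurableType disp)
    (P : probability T R) (X : 'I_N -> nat -> {RV P >-> lattice d}),
  independent_walks X ->
  forall z a b : lattice d,
  (4 * sqnorm R a <= sqnorm R z)%R -> (4 * sqnorm R b <= sqnorm R z)%R ->
  \int[P]_w (local_time R X z a w * local_time R X z b w)
     <= C%:E * (conv_pow0 (pot (@delta0 R d)) N (z - a)%R +
          conv_pow0 (pot (@delta0 R d)) N (z - b)%R) *
        conv_pow0 (pot (@delta0 R d)) N (a - b)%R.
Proof.
move=> N0 Nd; have d3 : (2 < d)%N by lia.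
(* Every walk counts for exactly one of the two exponents, so they add up to [N], as
   [esum_green_triple_le] requires. *)
have cnt (eps : {ffun 'I_N -> bool}) : (\sum_i eps i + \sum_i ~~ eps i = N)%N.
  rewrite -big_split/= -[RHS]card_ord -sum1_card.
  by apply: eq_bigr => i _; case: (eps i).
have /choice[C hC] : forall eps : {ffun 'I_N -> bool}, exists C : R, (0 < C)%R /\
    forall z a b : lattice d,
    (4 * sqnorm R a <= sqnorm R z)%R -> (4 * sqnorm R b <= sqnorm R z)%R ->
    \esum_(w in [set: lattice d])
      (conv_pow0 (pot (@delta0 R d)) N w *
       (conv_pow0 (pot (@delta0 R d)) (\sum_i eps i)%N (a - z - w)%R *
        conv_pow0 (pot (@delta0 R d)) (\sum_i ~~ eps i)%N (b - z - w)%R))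
    <= C%:E * (conv_pow0 (pot (@delta0 R d)) N (z - a)%R +
         conv_pow0 (pot (@delta0 R d)) N (z - b)%R) *
       conv_pow0 (pot (@delta0 R d)) N (a - b)%R.
  move=> eps; have := @esum_green_triple_le R d d3 (\sum_i eps i)%N (\sum_i ~~ eps i)%N.
  by rewrite cnt; apply.
exists (1 + \sum_eps C eps)%R; split.
  by rewrite ltr_pwDl// sumr_ge0// => eps _; rewrite ltW//; case: (hC eps).
move=> disp T P X hX z a b az bz; set G := conv_pow0 _ N.
have G0 x : 0 <= G x by apply: conv_pow0_ge0; exact: gr_ge0.
apply: le_trans (second_moment_le hX z a b) _.
set S := G (z - a)%R + G (z - b)%R.
have S0 : 0 <= S by rewrite adde_ge0.
apply: le_trans (_ : \esum_(eps in [set: {ffun 'I_N -> bool}])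
    ((S * G (a - b)%R) * (C eps)%:E) <= _).
  apply: le_esum => eps _; rewrite muleC muleA; exact: (hC eps).2.
have C0 eps : (0 <= C eps)%R by rewrite ltW//; case: (hC eps).
rewrite esumZl; last 2 first.
- by rewrite mule_ge0.
- by move=> eps; rewrite lee_fin.
rewrite esum_fin; last by move=> eps; rewrite lee_fin.
rewrite sumEFin muleC muleA; apply: lee_wpmul2r => //; apply: lee_wpmul2r => //.
by rewrite lee_fin lerDr.
Qed.

End second_moment_bound.

Theorem lemma1p3 (R : realType) (d : nat) :
  exists C : R, 0 < C /\
  forall (N : nat) (N1 : (1 <= N)%N), (2 * N < d)%N ->
  forall (disp : measure_display) (T : measurableType disp)
    (P : probability T R) (X : 'I_N -> nat -> {RV P >-> lattice d}),
  independent_walks X ->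
  forall z a b : lattice d,
  2 * Num.max (enorm R a) (enorm R b) <= enorm R z ->
  let G := conv_pow (green P (X (Ordinal N1))) N in
  (\int[P]_w (local_time R X z a w * local_time R X z b w)
     <= C%:E * (G (z - a)%R + G (z - b)%R) * G (a - b)%R)%E.
Proof.
(* A constant is chosen for every [N], with the dummy value 1 outside the range [0 < N],
   [2 * N < d]. *)
have /choice[C hC] : forall N : nat, exists C : R, (0 < C)%R /\
    ((0 < N)%N -> (2 * N < d)%N ->
  forall (disp : measure_display) (T : measurableType disp)
    (P : probability T R) (X : 'I_N -> nat -> {RV P >-> lattice d}),
  independent_walks X ->
  forall z a b : lattice d,
  (4 * sqnorm R a <= sqnorm R z)%R -> (4 * sqnorm R b <= sqnorm R z)%R ->
  (\int[P]_w (local_time R X z a w * local_time R X z b w)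
     <= C%:E * (conv_pow0 (pot (@delta0 R d)) N (z - a)%R +
          conv_pow0 (pot (@delta0 R d)) N (z - b)%R) *
        conv_pow0 (pot (@delta0 R d)) N (a - b)%R)%E).
  move=> N; have [/andP[N0 Nd]|NN] := boolP ((0 < N)%N && (2 * N < d)%N).
    by have [C [C0 hC]] := second_moment_bound R N0 Nd; exists C.
  by exists 1%R; split => // N0 Nd; rewrite N0 Nd in NN.
(* Since [2 * N < d] forces [N < d], this sum dominates every relevant constant and depends on [d]
   alone. *)
exists (1 + \sum_(N < d) C N)%R.
have C0 N : (0 < C N)%R by case: (hC N).
split; first by rewrite ltr_pwDl// sumr_ge0// => N _; rewrite ltW.
move=> N N1 Nd disp T P X hX z a b zab; lazy zeta.
set G := conv_pow _ N.
have sq (x : lattice d) : (enorm R x ^+ 2 = sqnorm R x)%R.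
  by rewrite sqr_sqrtr// sqnorm_ge0.
have en0 (x : lattice d) : (0 <= enorm R x)%R by exact: sqrtr_ge0.
have az : (4 * sqnorm R a <= sqnorm R z)%R.
  have : (enorm R a <= Num.max (enorm R a) (enorm R b))%R by rewrite le_max lexx.
  by rewrite -!sq; have := en0 a; nra.
have bz : (4 * sqnorm R b <= sqnorm R z)%R.
  have : (enorm R b <= Num.max (enorm R a) (enorm R b))%R by rewrite le_max lexx orbT.
  by rewrite -!sq; have := en0 b; nra.
(* All simple random walks have the same Green's function, so taking it from the walk of index 0 is
   harmless. *)
have GE : G = conv_pow0 (pot (@delta0 R d)) N.
  rewrite /G green_walk; last by case: hX.
  by rewrite conv_powE.
rewrite GE.
have [_ /(_ N1 Nd disp T P X hX z a b az bz)] := hC N.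
move=> h; apply: le_trans h _.
have G0 x : (0 <= conv_pow0 (pot (@delta0 R d)) N x)%E by apply: conv_pow0_ge0; exact: gr_ge0.
apply: lee_wpmul2r => //; apply: lee_wpmul2r; first by rewrite adde_ge0.
have Nd' : (N < d)%N by lia.
rewrite lee_fin (bigD1 (Ordinal Nd'))//= addrCA lerDl addr_ge0// sumr_ge0// => i _.
exact: ltW.
Qed.
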